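(* Let $p$ be an odd prime, let $n\ge4$ be an even integer, and let $f:\mathbb{F}_p^n\to\mathbb{F}_p$ be a non-weakly regular bent function belonging to $\mathcal{DBF}$. Suppose $B_-(f^* )$ is a non-degenerate $r$-dimensional subspace over $\mathbb{F}_p$ with $\frac n2+1\le r\le n-1$. Let $P$, $D$, $T$ be the sets of all nonempty members of, respectively, $$\mathcal{P}=\{\{0\},\,c_0(f)\setminus\{0\},\,c_1(f),\dots,c_{p-1}(f),\,d_0(f)\setminus\{0\},\,d_1(f),\dots,d_{p-1}(f)\},$$ $$\mathcal{D}=\Big\{\{0\},\,c_0(f)\setminus\{0\},\,\bigcup_{i\in SQ}c_i(f),\,\bigcup_{i\in NSQ}c_i(f),\,d_0(f)\setminus\{0\},\,\bigcup_{i\in SQ}d_i(f),\,\bigcup_{i\in NSQ}d_i(f)\Big\},$$ $$\mathcal{T}=\Big\{\{0\},\,c_0(f)\setminus\{0\},\,\bigcup_{i\in\mathbb{F}_p^*}c_i(f),\,d_0(f)\setminus\{0\},\,\bigcup_{i\in\mathbb{F}_p^*}d_i(f)\Big\}.$$ Then, for each of the three partitions $P$, $D$, $T$ of $\mathbb{F}_p^n$, the partition induces a symmetric association scheme if and only if $r=\frac n2+1$.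
   Context: Let $p$ be an odd prime, $n$ a positive integer, $x\cdot y$ the ordinary inner product on $\mathbb{F}_p^n$, and $\xi_p=e^{2\pi\sqrt{-1}/p}$. $SQ$ and $NSQ$ denote the sets of squares and of nonsquares in $\mathbb{F}_p^*$. Bent functions. For $f:\mathbb{F}_p^n\to\mathbb{F}_p$ the Walsh transform is $\mathcal{W}_f(\alpha)=\sum_{x\in\mathbb{F}_p^n}\xi_p^{f(x)-\alpha\cdot x}$, $\alpha\in\mathbb{F}_p^n$; $f$ is bent if $|\mathcal{W}_f(\alpha)|=p^{n/2}$ for all $\alpha$. Put $\mu=1$ if $p^n\equiv1\pmod 4$ and $\mu=\sqrt{-1}$ if $p^n\equiv3\pmod4$. For a bent $f$ it is known that for every $\alpha$, $\mathcal{W}_f(\alpha)\in\{\mu p^{n/2}\xi_p^{f^*(\alpha)},-\mu p^{n/2}\xi_p^{f^*(\alpha)}\}$ for a (unique) function $f^*:\mathbb{F}_p^n\to\mathbb{F}_p$, called the dual of $f$. A bent $f$ is weakly regular if there is $\lambda\in\{\pm1,\pm\sqrt{-1}\}$ independent of $\alpha$ with $\mathcal{W}_f(\alpha)=\lambda p^{n/2}\xi_p^{f^*(\alpha)}$ for all $\alpha$; otherwise it is non-weakly regular. A bent $f$ is dual-bent if $f^*$ is also bent. For a bent function $f$: $B_+(f)=\{\alpha:\mathcal{W}_f(\alpha)=\mu p^{n/2}\xi_p^{f^*(\alpha)}\}$ and $B_-(f)=\{\alpha:\mathcal{W}_f(\alpha)=-\mu p^{n/2}\xi_p^{f^*(\alpha)}\}$.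 For $f$ dual-bent, $B_\pm(f^* )$ are defined by the same formulas applied to the bent function $f^*$. For dual-bent $f$ and $j\in\mathbb{F}_p$: $c_j(f)=\{x\in B_+(f^* ):f(x)=j\}$, $d_j(f)=\{x\in B_-(f^* ):f(x)=j\}$. $\mathcal{DBF}$ is the set of dual-bent functions $f:\mathbb{F}_p^n\to\mathbb{F}_p$ such that $f(0)=0$ and there is a positive integer $h$ with $\gcd(h-1,p-1)=1$ and $f(ax)=a^hf(x)$ for all $a\in\mathbb{F}_p^*$, $x\in\mathbb{F}_p^n$. A subspace $V$ of $\mathbb{F}_p^n$ is non-degenerate if $\{x\in V:x\cdot y=0\ \text{for all } y\in V\}=\{0\}$. Association schemes. A $d$-class association scheme on a nonempty finite set $X$ is a partition of $X\times X$ into relations $R_0,\dots,R_d$ such that $R_0=\{(x,x):x\in X\}$; for each $j$ the transpose $R_j^T$ equals some $R_{j'}$; and for all $u,v,w$ and $(x,y)\in R_w$ the number $|\{z\in X:(x,z)\in R_u,(z,y)\in R_v\}|$ depends only on $u,v,w$. It is symmetric if $R_j^T=R_j$ for all $j$. A partition $\{U_i\}_{i=0}^d$ of $\mathbb{F}_p^n$ (into nonempty sets) with $U_0=\{0\}$ induces a symmetric association scheme if the relations $R_i=\{(\alpha,\beta):\alpha-\beta\in U_i\}$, $0\le i\le d$, form a symmetric association scheme on $\mathbb{F}_p^n$. *)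

(* Defs.v *)
(* MathComp finite algebra, with the complex numbers R[i] over a realType R. *)
From HB Require Import structures.
From mathcomp Require Import all_boot all_order all_algebra.
From mathcomp Require Import reals trigo.
From mathcomp Require Import complex.

Set Implicit Arguments.
Unset Strict Implicit.
Unset Printing Implicit Defensive.

Import GRing.Theory Num.Theory.
Local Open Scope ring_scope.
Local Open Scope complex_scope.

Definition inner (p n : nat) (x y : 'rV['F_p]_n) : 'F_p :=
  \sum_(i < n) x 0 i * y 0 i.

Definition nondegenerate_subspace (p n : nat) (V : {vspace 'rV['F_p]_n}) : Prop :=
  forall x, x \in V -> (forall y, y \in V -> inner x y = 0) -> x = 0.

Section Bent.
Variables (R : realType) (p n : nat).
Local Notation vec := 'rV['F_p]_n.
Implicit Types (f : vec -> 'F_p) (a x : vec).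

(* exp(2 pi i / p), through Euler's formula *)
Definition xi : R[i] :=
  cos (2 * pi / p%:R) +i* sin (2 * pi / p%:R).

(* xi ^ j for j in F_p: the exponent is the representative of j in [0, p) *)
Definition xi_pow (j : 'F_p) : R[i] := xi ^+ (j : nat).

Definition walsh f a : R[i] := \sum_(x : vec) xi_pow (f x - inner a x).

(* p ^ (n / 2), with n of any parity *)
Definition half_pow : R[i] := (Num.sqrt (p%:R ^+ n))%:C.

(* the two cases are p ^ n = 1 and p ^ n = 3 modulo 4 when p is odd *)
Definition mu : R[i] := if (p ^ n == 1 %[mod 4])%N then 1 else 'i%C.

Definition bent f : Prop := forall a, `|walsh f a| = half_pow.

(* For f bent and p an odd prime there is exactly one j as below at each a,
   so the default value 0 is never used. *)
Definition bent_dual f a : 'F_p :=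
  odflt 0 [pick j : 'F_p | (walsh f a == mu * half_pow * xi_pow j)
                        || (walsh f a == - mu * half_pow * xi_pow j)].

Definition weakly_regular f : Prop :=
  exists2 lambda : R[i], lambda \in [:: 1; -1; 'i%C; - 'i%C] &
    forall a, walsh f a = lambda * half_pow * xi_pow (bent_dual f a).

Definition dual_bent f : Prop := bent f /\ bent (bent_dual f).

Definition Bplus f : {set vec} :=
  [set a | walsh f a == mu * half_pow * xi_pow (bent_dual f a)].

Definition Bminus f : {set vec} :=
  [set a | walsh f a == - mu * half_pow * xi_pow (bent_dual f a)].

Definition cset f (j : 'F_p) : {set vec} :=
  [set x in Bplus (bent_dual f) | f x == j].

Definition dset f (j : 'F_p) : {set vec} :=
  [set x in Bminus (bent_dual f) | f x == j].

Definition DBF f : Prop :=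
  [/\ dual_bent f, f 0 = 0 &
      exists h : nat, [/\ (0 < h)%N, gcdn (h - 1) (p - 1) = 1%N &
        forall (a : 'F_p) x, a != 0 -> f (a *: x) = a ^+ h * f x]].

Definition SQ : {set 'F_p} :=
  [set j | (j != 0) && [exists k : 'F_p, j == k ^+ 2]].

Definition NSQ : {set 'F_p} :=
  [set j | (j != 0) && ~~ [exists k : 'F_p, j == k ^+ 2]].

Definition nonempty_members (F : {set {set vec}}) : {set {set vec}} :=
  [set A in F | A != set0].

Definition Ppart f : {set {set vec}} :=
  nonempty_members
    ([set [set 0]; cset f 0 :\ 0; dset f 0 :\ 0]
     :|: [set cset f j | j in [set~ 0]] :|: [set dset f j | j in [set~ 0]]).

Definition Dpart f : {set {set vec}} :=
  nonempty_members
    [set [set 0];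
         cset f 0 :\ 0; \bigcup_(i in SQ) cset f i; \bigcup_(i in NSQ) cset f i;
         dset f 0 :\ 0; \bigcup_(i in SQ) dset f i; \bigcup_(i in NSQ) dset f i].

Definition Tpart f : {set {set vec}} :=
  nonempty_members
    [set [set 0];
         cset f 0 :\ 0; \bigcup_(i in [set~ 0]) cset f i;
         dset f 0 :\ 0; \bigcup_(i in [set~ 0]) dset f i].

End Bent.

Section AssociationScheme.
Variables (X : finType) (d : nat).
Implicit Type Rel : 'I_d.+1 -> {set X * X}.

Definition transpose_rel (S : {set X * X}) : {set X * X} :=
  [set u | (u.2, u.1) \in S].

Definition association_scheme Rel : Prop :=
  [/\ (0 < #|X|)%N,
      [/\ forall i, Rel i != set0,
          forall i j, i != j -> [disjoint Rel i & Rel j] &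
          \bigcup_i Rel i = [set: X * X]],
      Rel ord0 = [set u | u.1 == u.2],
      forall j, exists j', transpose_rel (Rel j) = Rel j' &
      forall u v w, exists q : nat, forall x y, (x, y) \in Rel w ->
        #|[set z | ((x, z) \in Rel u) && ((z, y) \in Rel v)]| = q].

Definition symmetric_association_scheme Rel : Prop :=
  association_scheme Rel /\ forall j, transpose_rel (Rel j) = Rel j.

End AssociationScheme.

(* The classes of the partition are enumerated without repetition as
   U_0, ..., U_d with U_0 = {0}. *)
Definition induces_symmetric_scheme (p n : nat)
    (P : {set {set 'rV['F_p]_n}}) : Prop :=
  exists (d : nat) (U : 'I_d.+1 -> {set 'rV['F_p]_n}),
    [/\ injective U, P = [set U i | i : 'I_d.+1], U ord0 = [set 0] &
        symmetric_association_scheme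
          (fun i => [set u : 'rV['F_p]_n * 'rV['F_p]_n | u.1 - u.2 \in U i])].

(* Main.v *)
Require Import Defs.
From mathcomp Require Import all_boot all_order all_algebra.
From mathcomp Require Import all_field.
From mathcomp Require cyclic.
From mathcomp Require Import zify ring.
From mathcomp Require Import reals trigo.
From mathcomp Require Import complex.

(* Write zeta = exp(2 pi i / p), chi(j) = zeta^j and q = p^(n/2).

   A Walsh value W of a bent function is a cyclotomic integer with W W* = q^2.
   Since p is, up to a unit, the (p-1)-st power of the prime 1 - zeta, this
   forces W = q u with u a cyclotomic integer and u u* = 1; comparing
   coefficients shows u = +-chi(j).

   Let g be the dual of f, B = B_-(f) and V = B_-(g). The dual of g is f
   again, and adding and subtracting Walsh inversion for f and g shows that
     sum_(x in V) chi(b^-1 f(x) - a.x) = - [a in B] q chi(b^t g(a)),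
   where t is inverse to h - 1 modulo p - 1; similarly outside V, and with f
   and g exchanged. So Fourier transforms of functions of
   ([x = 0], [x in V], class of f(x)) depend only on [a = 0], [a in B], the
   class of g(a) and [a in V^perp]. The orthogonal V^perp always lies in
   Z = {a in B | g(a) = 0}. If V^perp = Z, the transform carries the two
   partitions into each other, so functions constant on the classes are closed
   under convolution. If V^perp <> Z, closure would make the indicator of Z a
   transform of such a function, which the vanishing of Kloosterman-type sums
   excludes. Finally #|Z| is determined by #|B| = p^r, and #|Z| = #|V^perp|
   exactly when r = n/2 + 1. *)

Set Implicit Arguments.
Unset Strict Implicit.
Unset Printing Implicit Defensive.

Import Order.TTheory GRing.Theory Num.Theory.
Local Open Scope ring_scope.

(** * Characters of F_p and cyclotomic integers *)

Section Character.
Variables (C : numClosedFieldType) (p : nat) (z : C).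
Hypotheses (p_pr : prime p) (p_odd : odd p) (z_prim : p.-primitive_root z).

Definition addchar (j : 'F_p) : C := z ^+ (j : nat).
Local Notation chi := addchar.

Lemma chi_nat m : chi m%:R = z ^+ m.
Proof. by rewrite /addchar val_Fp_nat // prim_expr_mod. Qed.

Lemma chiD i j : chi (i + j) = chi i * chi j.
Proof. by rewrite -(natr_Zp i) -(natr_Zp j) -natrD !chi_nat exprD. Qed.

Lemma chi0 : chi 0 = 1.
Proof. by []. Qed.

Lemma chi_neq0 i : chi i != 0.
Proof.
have p0 := prime_gt0 p_pr; rewrite expf_neq0 //; apply/eqP => z0.
have /eqP := prim_expr_order z_prim.
by rewrite z0 expr0n (gtn_eqF p0) eq_sym oner_eq0.
Qed.

Lemma chiN i : chi (- i) = (chi i)^-1.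
Proof. by apply: (mulIf (chi_neq0 i)); rewrite -chiD addNr mulVf ?chi_neq0. Qed.

Lemma chi_eq1 i : (chi i == 1) = (i == 0).
Proof.
rewrite -(natr_Zp i) chi_nat -(prim_order_dvd z_prim).
by rewrite (dvdn_pcharf (pchar_Fp p_pr)).
Qed.

Lemma chi_pexp i : chi i ^+ p = 1.
Proof. by rewrite /addchar exprAC (prim_expr_order z_prim) expr1n. Qed.

Lemma chi_neqN1 i : chi i != -1.
Proof.
apply/eqP => e; have := chi_pexp i; rewrite e -signr_odd p_odd expr1 => /eqP.
by rewrite eq_sym -addr_eq0 -[1 + 1]/(2%:R) pnatr_eq0.
Qed.

Lemma norm_chi i : `|chi i| = 1.
Proof.
apply: (@pexpIrn _ p _ _); rewrite ?nnegrE ?prime_gt0 //.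
by rewrite -normrX chi_pexp normr1 expr1n.
Qed.

Lemma conj_chi i : (chi i)^* = chi (- i).
Proof.
apply: (mulIf (chi_neq0 i)); rewrite -chiD addNr chi0.
by rewrite mulrC -normCK norm_chi expr1n.
Qed.

Lemma sum_chi v : \sum_i chi (i * v) = (v == 0)%:R * p%:R.
Proof.
case: eqVneq => [->|v0].
  rewrite (eq_bigr (fun=> 1)) => [|i _]; last by rewrite mulr0.
  by rewrite sumr_const card_Fp // mul1r.
rewrite mul0r; apply/eqP.
have e : chi v * (\sum_i chi (i * v)) = \sum_i chi (i * v).
  rewrite mulr_sumr [RHS](reindex_inj (addIr 1)) /=.
  by apply: eq_bigr => i _; rewrite -chiD mulrDl mul1r addrC.
have : (chi v - 1) * (\sum_i chi (i * v)) = 0 by rewrite mulrBl mul1r e subrr.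
by move/eqP; rewrite mulf_eq0 subr_eq0 chi_eq1 (negPf v0).
Qed.

(** This is the irreducibility over the rationals of U = 1 + X + ... + X^(p-1). Minimal polynomials
    are computed in [algC], whereas [z] lies in [C]; the gcd of [P] and [U] over [rat] carries a
    common root from one field to the other. *)
Lemma prim_root_rat_poly (P : {poly rat}) : (size P <= p)%N ->
  (map_poly ratr P).[z] = 0 -> exists c, P = c *: \sum_(i < p) 'X^i.
Proof.
move=> sP rP.
have p1 := prime_gt1 p_pr; have p0 := prime_gt0 p_pr.
pose U : {poly rat} := \sum_(i < p) 'X^i.
have mapU (F : numClosedFieldType) : map_poly (ratr : rat -> F) U =
  \sum_(i < p) 'X^i.
  by rewrite rmorph_sum; apply: eq_bigr => i _; rewrite /= map_polyXn.
have sU : size U = p.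
  rewrite (_ : U = \poly_(i < p) 1) ?size_poly_eq ?oner_neq0 //.
  by rewrite poly_def; apply: eq_bigr => i _; rewrite scale1r.
have U1 (F : numClosedFieldType) (w : F) :
    (w - 1) * (map_poly (ratr : rat -> F) U).[w] = w ^+ p - 1.
  rewrite mapU -[p in RHS]prednK // subrX1 prednK //; congr (_ * _).
  by rewrite horner_sum; apply: eq_bigr => i _; rewrite hornerXn.
have z1 : z != 1.
  apply/eqP => z1; have := chi_eq1 1; rewrite oner_eq0 /addchar z1 expr1n eqxx //.
have rU : (map_poly ratr U).[z] = 0.
  apply/eqP; have /eqP := U1 _ z.
  by rewrite (prim_expr_order z_prim) subrr mulf_eq0 subr_eq0 (negPf z1).
have irr (w : algC) : (map_poly ratr U).[w] = 0 ->
    forall q : {poly rat}, root (map_poly ratr q) w = (U %| q).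
  move=> rw; have wp : w ^+ p = 1.
    by apply/eqP; rewrite -subr_eq0 -U1 rw mulr0.
  have [m pm mp] := prim_order_exists p0 wp.
  (* The order of w divides p, and it is not 1 because U takes the value p at 1. *)
  have m_p : m = p.
    case/primeP: p_pr => _ /(_ m mp)/orP[]/eqP // m1.
    move: rw; rewrite mapU horner_sum (eq_bigr (fun=> 1)) => [|i _].
      by move/eqP; rewrite sumr_const card_ord pnatr_eq0 (gtn_eqF p0).
    by move: pm; rewrite m1 hornerXn => /prim_expr_order; rewrite expr1 => ->;
      rewrite expr1n.
  subst m; have [q [eq qm] qP] := minCpolyP w.
  have sq : size q = p.
    have := minCpoly_cyclotomic pm;
      rewrite eq => /(congr1 (fun q : {poly _} => size q)).
    by rewrite size_map_poly size_cyclotomic totient_prime // prednK.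
  have qU : q %= U.
    have qU : q %| U by rewrite -qP rootE rw.
    by rewrite -dvdp_size_eqp // sq sU.
  by move=> Q; rewrite qP (eqp_dvdl _ qU).
have [cop|ncop] := boolP (coprimep P U).
  have /Bezout_eq1_coprimepP[[u v] /= e] := cop.
  have := congr1 (fun q => (map_poly (ratr : rat -> C) q).[z]) e.
  rewrite rmorphD !rmorphM rmorph1 !hornerE rP rU !mulr0 addr0 => /eqP.
  by rewrite eq_sym oner_eq0.
have /closed_rootP[w rw] : size (map_poly (ratr : rat -> algC) (gcdp P U)) != 1%N.
  by rewrite size_map_poly.
have rUw : (map_poly (ratr : rat -> algC) U).[w] = 0.
  rewrite -[U](divpK (dvdp_gcdr P U)).
  by rewrite rmorphM hornerM (eqP rw) mulr0.
have : U %| P.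
  rewrite -(irr w rUw) rootE -[P](divpK (dvdp_gcdl P U)).
  by rewrite rmorphM hornerM (eqP rw) mulr0.
have U0 : U != 0 by rewrite -size_poly_eq0 sU -lt0n.
rewrite dvdp_eq; set Q := P %/ U => /eqP PE.
exists Q`_0; rewrite {1}PE -/U.
have -> : Q = (Q`_0)%:P; last by rewrite coefC mul_polyC.
apply: size1_polyC; rewrite /Q size_divp // sU -subn1 leq_subLR subnK //.
Qed.

End Character.

(** * Arithmetic of Z[z] and cyclotomic integers of absolute value p^k *)

Section CyclotomicIntegers.
Variables (C : numClosedFieldType) (p : nat) (z : C).
Hypotheses (p_pr : prime p) (p_odd : odd p) (z_prim : p.-primitive_root z).
Local Notation chi := (@addchar C p z).

Lemma big_ord_Fp (T : zmodType) (G : 'F_p -> T) :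
  \sum_(i < p) G i%:R = \sum_j G j.
Proof.
rewrite [RHS](reindex (fun i : 'I_p => (i : nat)%:R)) //=.
exists (cast_ord (Fp_cast p_pr)) => [i|j] _; last by rewrite /= natr_Zp.
by apply: val_inj; rewrite /= val_Fp_nat // modn_small.
Qed.

(** The coefficients form a polynomial of size at most p that vanishes at [z], hence a multiple of 1
    + X + ... + X^(p-1). Every later comparison of coefficients rests on this. *)
Lemma chi_indep (a : 'F_p -> int) :
  \sum_j (a j)%:~R * chi j = 0 -> forall i j, a i = a j.
Proof.
move=> a0.
have [] := @prim_root_rat_poly C p z p_pr z_prim (\poly_(i < p) (a i%:R)%:~R).
- exact: size_poly.
- rewrite -[RHS]a0 -big_ord_Fp poly_def rmorph_sum horner_sum.
  apply: eq_bigr => i _; rewrite /= linearZ /= map_polyXn hornerE hornerXn.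
  by rewrite ratr_int chi_nat.
move=> c /polyP cP.
have aE (i : 'F_p) : (a i)%:~R = c.
  have := cP i; rewrite coefZ -[\sum_(_ < _) _](_ : \poly_(i < p) 1 = _).
    have ip : (i < p)%N by rewrite -[X in (_ < X)%N](Fp_cast p_pr).
    by rewrite !coef_poly ip mulr1 natr_Zp.
  by rewrite poly_def; apply: eq_bigr => k _; rewrite scale1r.
by move=> i j; apply: (@intr_inj rat); rewrite !aE.
Qed.

(** Elements of Z[z] are given by integer polynomials because evaluating these at 1 modulo p is
    reduction modulo 1 - z. *)
Definition cint (P : {poly int}) : C := (map_poly intr P).[z].

Lemma cintB P Q : cint (P - Q) = cint P - cint Q.
Proof. by rewrite /cint rmorphB hornerD hornerN. Qed.

Lemma cintN P : cint (- P) = - cint P.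
Proof. by rewrite /cint rmorphN hornerN. Qed.

Lemma cint_X : cint 'X = z.
Proof. by rewrite /cint map_polyX hornerX. Qed.

Lemma cintM P Q : cint (P * Q) = cint P * cint Q.
Proof. by rewrite /cint rmorphM hornerM. Qed.

Lemma cint1 : cint 1 = 1.
Proof. by rewrite /cint rmorph1 hornerC. Qed.

Lemma cintX n : cint 'X^n = z ^+ n.
Proof. by rewrite /cint map_polyXn hornerXn. Qed.

Lemma cint_exp P n : cint (P ^+ n) = cint P ^+ n.
Proof. by rewrite /cint rmorphXn horner_exp. Qed.

Lemma cintZ c P : cint (c *: P) = c%:~R * cint P.
Proof. by rewrite /cint map_polyZ hornerZ. Qed.

Lemma cint_sum (I : finType) (F : I -> {poly int}) :
  cint (\sum_i F i) = \sum_i cint (F i).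
Proof. by rewrite /cint rmorph_sum horner_sum. Qed.

(** Exponents are folded modulo p, which preserves both the value at [z] and the value at 1. *)
Lemma cint_reduce (P : {poly int}) : exists2 a : 'F_p -> int,
  cint P = \sum_j (a j)%:~R * chi j & P.[1] = \sum_j a j.
Proof.
exists (fun j => \sum_(i < size P | (i : nat)%:R == j) P`_i).
  rewrite /cint (@horner_coef_wide _ (size P)) ?size_poly //.
  rewrite (partition_big (fun i : 'I_(size P) => (i : nat)%:R : 'F_p) predT) //=.
  apply: eq_bigr => j _; rewrite rmorph_sum mulr_suml.
  apply: eq_bigr => i /eqP <-; rewrite chi_nat // coef_map_id0 //.
rewrite horner_coef (partition_big (fun i : 'I_(size P) =>
  (i : nat)%:R : 'F_p) predT) //=.
by apply: eq_bigr => j _; apply: eq_bigr => i _; rewrite expr1n mulr1.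
Qed.

(** Reduction modulo 1 - z is well defined: the folded coefficients of P - Q are all equal, so their
    sum is a multiple of p. *)
Lemma cint_eq_mod P Q : cint P = cint Q -> (p %| P.[1] - Q.[1])%Z.
Proof.
move=> /eqP; rewrite -subr_eq0 -cintB => /eqP PQ.
rewrite -hornerN -hornerD; have [a aE ->] := cint_reduce (P - Q).
have /chi_indep ac : \sum_j (a j)%:~R * chi j = 0 by rewrite -aE.
have -> : \sum_j a j = \sum_(j : 'F_p) a 0 by apply: eq_bigr => j _; apply: ac.
by rewrite sumr_const card_Fp // -mulr_natr natz dvdz_mull.
Qed.

Lemma sum_chi_all : \sum_(i : 'F_p) chi i = 0.
Proof.
have := sum_chi p_pr z_prim 1; rewrite oner_eq0 mul0r => s0.
by rewrite -[RHS]s0; apply: eq_bigr => i _; rewrite mulr1.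
Qed.

Lemma sum_zpow : \sum_(i < p) z ^+ i = 0.
Proof.
by rewrite -[RHS]sum_chi_all -big_ord_Fp; apply: eq_bigr => i _; rewrite chi_nat.
Qed.

(** Subtracting c (1 + X + ... + X^(p-1)), which vanishes at [z] and equals c p at 1, makes 1 a
    root, so that X - 1 splits off. *)
Lemma cint_dvd (P : {poly int}) : (p %| P.[1])%Z ->
  exists Q, cint P = (1 - z) * cint Q.
Proof.
case/dvdzP=> c Pc.
have /factor_theorem[Q QE] : root (P - c *: \sum_(i < p) 'X^i) 1.
  rewrite rootE hornerD hornerN hornerZ horner_sum (eq_bigr (fun=> 1)).
    by rewrite sumr_const card_ord Pc natz subrr.
  by move=> i _; rewrite hornerXn expr1n.
exists (- Q).
have := congr1 cint QE; rewrite cintB cintZ cint_sum.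
rewrite (eq_bigr (fun i : 'I_p => z ^+ i)) => [|i _]; last exact: cintX.
rewrite sum_zpow mulr0 subr0 => ->.
rewrite cintM cintB polyC1 cint1 cint_X cintN.
by rewrite mulrN -mulNr opprB mulrC.
Qed.

Lemma conj_z : z^* = z ^+ p.-1.
Proof.
have e : z * z ^+ p.-1 = 1 by rewrite -exprS prednK ?prime_gt0 //
  (prim_expr_order z_prim).
have z0 : z != 0 by apply: contra_eq_neq e => ->; rewrite mul0r eq_sym oner_neq0.
apply: (mulfI z0); rewrite e -normCK.
have := norm_chi p_pr z_prim 1; rewrite /addchar /= expr1 => ->.
by rewrite expr1n.
Qed.

Lemma conj_cint P : (cint P)^* = cint (P \Po 'X^(p.-1)).
Proof.
rewrite /cint -horner_map /= conj_z map_comp_poly map_polyXn horner_comp hornerXn.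
congr (_.[_]); rewrite -map_poly_comp; apply: eq_map_poly => m /=.
by rewrite rmorph_int.
Qed.

Lemma conj1z : (1 - z)^* = (1 - z) * - z ^+ p.-1.
Proof.
rewrite rmorphB rmorph1 /= conj_z mulrBl mul1r mulrN opprK -exprS.
by rewrite prednK ?prime_gt0 // (prim_expr_order z_prim) addrC.
Qed.

Lemma onemz_neq0 : 1 - z != 0.
Proof.
rewrite subr_eq0 eq_sym; have := chi_eq1 p_pr z_prim 1.
by rewrite /addchar /= expr1 oner_eq0 => ->.
Qed.

(* 1 - z generates a prime ideal stable under conjugation. *)
Lemma cint_dvd_norm m P W : cint P * (cint P)^* = (1 - z) ^+ (m + m) * cint W ->
  exists Q, cint P = (1 - z) ^+ m * cint Q.
Proof.
elim: m P W => [|m IH] P W PW; first by exists P; rewrite mul1r.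
(* Conjugation is trivial modulo 1 - z, so the hypothesis reduces to P(1)^2 = 0 modulo p. *)
have pdv : (p %| P.[1])%Z.
  have : cint (P * (P \Po 'X^(p.-1))) = cint ((1 - 'X) ^+ (m.+1 + m.+1) * W).
    rewrite cintM -conj_cint PW cintM cint_exp cintB cint1.
    by rewrite cint_X.
  move/cint_eq_mod; rewrite !hornerM horner_comp hornerXn expr1n.
  rewrite horner_exp hornerD hornerN hornerX hornerC subrr expr0n mul0r subr0.
  by rewrite !dvdzE /= abszM Euclid_dvdM // orbb.
have [Q PQ] := cint_dvd pdv.
(* The conjugate of 1 - z is (1 - z) times the unit -z^(p-1); the factor -X moves the inverse of
   this unit to the right-hand side. *)
have [|Q' Q'E] := IH Q (W * (- 'X)).
  apply: (mulfI (expf_neq0 2 onemz_neq0)); move: PW; rewrite PQ rmorphM /= conj1z.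
  move=> PW; rewrite [RHS]mulrA -exprD (_ : 2 + (m + m) = m.+1 + m.+1)%N;
    last by lia.
  have zp : z ^+ p.-1 * z = 1 by rewrite -exprSr prednK ?prime_gt0 //
    (prim_expr_order z_prim).
  rewrite cintM cintN cint_X [RHS]mulrA -PW /=.
  transitivity ((1 - z) ^+ 2 * (cint Q * (cint Q)^*) * (z ^+ p.-1 * z));
    last by ring.
  by rewrite zp mulr1.
by exists Q'; rewrite PQ Q'E exprS mulrA.
Qed.

(** Divide the factorization of X^p - 1 by X - 1 and evaluate at 1. *)
Lemma prod_1z : \prod_(i < p.-1) (1 - z ^+ i.+1) = p%:R.
Proof.
have p0 := prime_gt0 p_pr.
have := factor_Xn_sub_1 z_prim.
rewrite big_mkord -[in X in X = _](prednK p0) big_ord_recl expr0 polyC1 subrX1.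
move/(mulfI (monic_neq0 (monicXsubC _)))/(congr1 (horner^~ 1)).
rewrite horner_prod horner_sum => e;
  transitivity (\sum_(i < p) ('X^i : {poly C}).[1]).
  rewrite -e; apply: eq_bigr => i _; by rewrite !hornerE.
rewrite (eq_bigr (fun=> 1)) ?sumr_const ?card_ord // => i _.
by rewrite hornerXn expr1n.
Qed.

Lemma p_dvd_pi : exists A, p%:R = (1 - z) ^+ p.-1 * cint A.
Proof.
rewrite -prod_1z -[in X in _ ^+ X](card_ord p.-1) -prodr_const.
apply: (big_ind2 (fun x y => exists A, x = y * cint A)).
- by exists 1; rewrite cint1 mulr1.
- by move=> x1 y1 x2 y2 [A ->] [B ->]; exists (A * B); rewrite cintM mulrACA.
move=> i _; exists (\sum_(j < i.+1) 'X^j).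
rewrite cint_sum (eq_bigr (fun j : 'I__ => z ^+ j)) => [|j _]; last exact: cintX.
by rewrite -[LHS]opprB subrX1 -mulNr opprB.
Qed.

(** Each 1 - z^(i+1) divides 1 - z, because z is in turn a power of z^(i+1), with exponent the
    inverse of i + 1 modulo p. *)
Lemma pi_dvd_p : exists B, (1 - z) ^+ p.-1 = p%:R * cint B.
Proof.
rewrite -prod_1z; have -> : (1 - z) ^+ p.-1 = \prod_(i < p.-1) (1 - z).
  by rewrite prodr_const card_ord.
apply: (big_ind2 (fun x y => exists A, x = y * cint A)).
- by exists 1; rewrite cint1 mulr1.
- by move=> x1 y1 x2 y2 [A ->] [B ->]; exists (A * B); rewrite cintM mulrACA.
move=> i _.
have ip : ((i.+1)%:R : 'F_p) != 0.
  rewrite -(dvdn_pcharf (pchar_Fp p_pr)) gtnNdvd //.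
  by rewrite -[X in (_ < X)%N](prednK (prime_gt0 p_pr)) ltnS.
pose k : nat := (i.+1%:R : 'F_p)^-1.
have zk : z ^+ (i.+1 * k) = z.
  rewrite -(chi_nat p_pr z_prim) natrM natr_Zp mulfV //.
exists (\sum_(j < k) 'X^(i.+1 * j)).
rewrite cint_sum (eq_bigr (fun j : 'I__ => (z ^+ i.+1) ^+ j)) => [|j _].
  by rewrite -[X in X * _]opprB mulNr -subrX1 -exprM zk opprB.
by rewrite cintX exprM.
Qed.

(** The coefficients of u u* are the autocorrelations A(d). By independence u u* = 1 forces A(d) =
    A(0) - 1 + [d = 0], and the sum of all A(d) is the square of the sum of the a(j). *)
Lemma unit_autocorrelation (a : 'F_p -> int) :
  let u := \sum_j (a j)%:~R * chi j in
  u * u^* = 1 -> (\sum_j a j) ^+ 2 = 1 + p%:Z * ((\sum_j a j ^+ 2) - 1).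
Proof.
move=> u; pose A (d : 'F_p) : int := \sum_j a (j + d) * a j.
have uu : u * u^* = \sum_d (A d)%:~R * chi d.
  transitivity (\sum_j \sum_d
      (a (j + d))%:~R * chi (j + d) * ((a j)%:~R * chi j)^*).
    rewrite {2}/u rmorph_sum mulr_sumr; apply: eq_bigr => j _.
    by rewrite /u (reindex_inj (addrI j)) mulr_suml.
  rewrite exchange_big; apply: eq_bigr => d _ /=.
  rewrite rmorph_sum mulr_suml; apply: eq_bigr => j _.
  rewrite /= intrM [(_ * chi j)^*]rmorphM /= rmorph_int conj_chi // chiD //
    chiN //.
  field.
  exact: chi_neq0.
rewrite uu => A1.
have /chi_indep Ac : \sum_d (A d - (d == 0)%:Z)%:~R * chi d = 0.
  under eq_bigr do rewrite intrB mulrBl /=.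
  rewrite big_split sumrN A1 (bigD1 0) //= mul1r chi0 big1 ?addr0 ?subrr //.
  by move=> i /negPf ->; rewrite mul0r.
have A0 : A 0 = \sum_j a j ^+ 2 by apply: eq_bigr => j _; rewrite addr0 -expr2.
have AE d : A d = A 0 - 1 + (d == 0)%:Z.
  by have := Ac d 0; rewrite eqxx => /eqP; rewrite subr_eq => /eqP.
transitivity (\sum_d A d).
  rewrite exchange_big expr2 mulr_sumr; apply: eq_bigr => j _ /=.
  by rewrite (reindex_inj (addrI j)) mulr_suml.
rewrite (eq_bigr _ (fun d _ => AE d)) big_split /= sumr_const card_Fp // -A0.
rewrite (bigD1 0) //= big1 ?eqxx; last by move=> i /negPf ->.
by rewrite addr0 addrC -mulr_natl natz.
Qed.

(* Shifting all coefficients by a constant does not change u, so their sum can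
   be taken to be +-1; then the squares of the coefficients sum to 1. *)
Lemma unit_root (a : 'F_p -> int) : let u := \sum_j (a j)%:~R * chi j in
  u * u^* = 1 -> exists j, u = chi j \/ u = - chi j.
Proof.
move=> u uu; have := unit_autocorrelation uu; set s := \sum_j a j => sE.
have [m [e [sme e1]]] : exists m e : int, s = e + p%:Z * m /\ e ^+ 2 = 1.
  have : (p %| (s - 1) * (s + 1))%Z.
    have -> : (s - 1) * (s + 1) = s ^+ 2 - 1 by ring.
    by rewrite sE addrC addKr dvdz_mulr.
  rewrite dvdzE abszM Euclid_dvdM // => /orP[] /dvdzP[m mE].
    by exists m, 1; split => //; rewrite mulrC -mE; ring.
  by exists m, (-1); split => //; rewrite mulrC -mE; ring.
pose b j := a j - m.
have ub : \sum_j (b j)%:~R * chi j = u.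
  under eq_bigr do rewrite intrB mulrBl /=.
  by rewrite big_split /= sumrN -mulr_sumr sum_chi_all mulr0 oppr0 addr0.
have := @unit_autocorrelation b; rewrite /= ub => /(_ uu).
have -> : \sum_j b j = e.
  rewrite big_split /= sumrN sumr_const card_Fp // -/s sme -[m *+ p]mulr_natl
    natz; ring.
rewrite e1 => /esym/eqP; rewrite -subr_eq0 addrC addKr mulf_eq0.
rewrite eqz_nat (gtn_eqF (prime_gt0 p_pr)) /= subr_eq0 => /eqP b1.
have [j bj] : exists j, b j != 0.
  apply/existsP; apply: contra_eqT b1; rewrite negb_exists => /forallP b0.
  by rewrite big1 // => j _; have /negPn/eqP -> := b0 j.
have bjge : 1 <= b j ^+ 2 by rewrite -gtz0_ge1 exprn_even_gt0.
have rest : \sum_(i | i != j) b i ^+ 2 >= 0 by apply: sumr_ge0 => i _;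
  exact: sqr_ge0.
have rest0 : \sum_(i | i != j) b i ^+ 2 = 0 /\ b j ^+ 2 = 1.
  by move: b1 bjge rest; rewrite (bigD1 j) //=;
    move: (b j ^+ 2) (\sum_(_ | _) _) => X Y; lia.
have bi i : i != j -> b i = 0.
  move=> ij; have /eqP := rest0.1; rewrite psumr_eq0 => [|k _];
    last exact: sqr_ge0.
  by move/allP/(_ i (mem_index_enum _)); rewrite ij sqrf_eq0 => /eqP.
exists j; rewrite -ub (bigD1 j) //= big1 => [|i ij]; last by rewrite bi // mul0r.
have /eqP := rest0.2; rewrite sqrf_eq1 => /orP[] /eqP ->; [left|right].
  by rewrite mul1r addr0.
by rewrite mulN1r addr0.
Qed.

Lemma char_sum_norm (I : finType) (F : I -> 'F_p) k :
  `|\sum_x chi (F x)| = (p ^ k)%:R ->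
  exists j, \sum_x chi (F x) = (p ^ k)%:R * chi j
         \/ \sum_x chi (F x) = - (p ^ k)%:R * chi j.
Proof.
move=> nF; set x := \sum_x _ in nF *.
have [P xP] : exists P, x = cint P.
  exists (\sum_x 'X^(F x)); rewrite cint_sum; apply: eq_bigr => y _.
  by rewrite cintX.
have pk0 : (p ^ k)%:R != 0 :> C by rewrite pnatr_eq0 -lt0n expn_gt0 prime_gt0.
have xx : x * x^* = (p ^ k)%:R ^+ 2 by rewrite -normCK nF.
have [A AE] := p_dvd_pi; have [B BE] := pi_dvd_p.
(* The norm p^(2k) is divisible by (1 - z)^(2k(p-1)), so x is divisible by (1 - z)^(k(p-1)), that
   is, by p^k. *)
have [|Q QE] := @cint_dvd_norm (p.-1 * k) P (A ^+ (k + k)).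
  by rewrite -xP xx natrX -exprM muln2 -addnn -mulnDr exprM cint_exp -exprMn -AE.
have xu : x = (p ^ k)%:R * cint (B ^+ k * Q).
  by rewrite xP QE cintM mulrA natrX cint_exp exprM BE exprMn.
have [a aE _] := cint_reduce (B ^+ k * Q).
have [|j ju] := @unit_root a.
  rewrite -aE; apply: (mulfI (expf_neq0 2 pk0)).
  rewrite mulr1 -[RHS]xx xu rmorphM rmorph_nat /=; ring.
exists j; rewrite xu aE; case: ju => ->; [left|right] => //.
by rewrite mulrN mulNr.
Qed.

End CyclotomicIntegers.

(** * Fourier transform on F_p^n *)

Section Inner.
Variables (p n : nat).
Hypothesis p_pr : prime p.
Local Notation vec := 'rV['F_p]_n.
Implicit Types (x y a : vec).

Lemma innerC x y : inner x y = inner y x.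
Proof. by apply: eq_bigr => i _; rewrite mulrC. Qed.

Lemma innerDr a x y : inner a (x + y) = inner a x + inner a y.
Proof. by rewrite -big_split; apply: eq_bigr => i _; rewrite mxE mulrDr. Qed.

Lemma innerZr a c x : inner a (c *: x) = c * inner a x.
Proof. by rewrite mulr_sumr; apply: eq_bigr => i _; rewrite mxE mulrCA. Qed.

Lemma innerZl a c x : inner (c *: a) x = c * inner a x.
Proof. by rewrite innerC innerZr innerC. Qed.

Lemma innerNr a x : inner a (- x) = - inner a x.
Proof. by rewrite -scaleN1r innerZr mulN1r. Qed.

Lemma innerNl a x : inner (- a) x = - inner a x.
Proof. by rewrite innerC innerNr innerC. Qed.

Lemma innerDl a b x : inner (a + b) x = inner a x + inner b x.
Proof. by rewrite innerC innerDr !(innerC x). Qed.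

Lemma inner0l x : inner 0 x = 0.
Proof. by rewrite -(scale0r 0) innerZl mul0r. Qed.

Lemma inner_nondeg a : (forall y, inner a y = 0) -> a = 0.
Proof.
move=> a0; apply/rowP => i; rewrite mxE -(a0 (delta_mx 0 i)).
rewrite /inner (bigD1 i) //= big1 => [|j /negPf ji].
  by rewrite mxE !eqxx mulr1 addr0.
by rewrite mxE ji andbF mulr0.
Qed.

Definition orth (V : {vspace vec}) : {set vec} :=
  [set a | [forall y in V, inner a y == 0]].

Lemma orth_fullv a : (a \in orth fullv) = (a == 0).
Proof.
rewrite inE; apply/forall_inP/eqP => [a0|-> y _]; last by rewrite inner0l.
by apply: inner_nondeg => y; apply/eqP/a0/memvf.
Qed.

Lemma inner_orth V a y : a \in orth V -> y \in V -> inner a y = 0.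
Proof. by rewrite inE => /forall_inP aV yV; apply/eqP/aV. Qed.

End Inner.

Section Fourier.
Variables (C : numClosedFieldType) (p n : nat) (z : C).
Hypotheses (p_pr : prime p) (p_odd : odd p) (z_prim : p.-primitive_root z).
Local Notation chi := (@addchar C p z).
Local Notation vec := 'rV['F_p]_n.

Lemma sum_chi_vspace (V : {vspace vec}) a :
  \sum_(y in V) chi (inner a y) = (a \in orth V)%:R * #|V|%:R.
Proof.
case: (boolP (a \in orth V)) => [aV|].
  rewrite (eq_bigr (fun=> 1)) ?sumr_const ?mul1r // => y yV.
  by rewrite (inner_orth aV yV).
rewrite inE => /forallPn[y0]; rewrite negb_imply => /andP[yV ay].
rewrite mul0r; apply/eqP.
have e : chi (inner a y0) * (\sum_(y in V) chi (inner a y)) =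
  \sum_(y in V) chi (inner a y).
  rewrite mulr_sumr [RHS](reindex_inj (addrI y0)) /=.
  apply: eq_big => y; first by rewrite rpredDl.
  by rewrite innerDr chiD.
have : (chi (inner a y0) - 1) * (\sum_(y in V) chi (inner a y)) = 0.
  by rewrite mulrBl mul1r e subrr.
by move/eqP; rewrite mulf_eq0 subr_eq0 chi_eq1 // (negPf ay).
Qed.

Lemma card_vec : #|{: vec}| = (p ^ n)%N.
Proof. by rewrite card_mx card_Fp // mul1n. Qed.

Lemma sum_chi_inner a : \sum_(y : vec) chi (inner a y) = (a == 0)%:R * (p ^ n)%:R.
Proof.
have -> : (p ^ n)%N = #|(fullv : {vspace vec})|.
  by rewrite -card_vec; apply: eq_card => y; rewrite memvf.
rewrite -orth_fullv // -sum_chi_vspace; apply: eq_bigl => y.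
by rewrite memvf.
Qed.

Definition fourier_transform (phi : vec -> C) a : C :=
  \sum_x phi x * chi (- inner a x).
Local Notation fourier := fourier_transform.

Lemma fourierK phi x : fourier (fourier phi) x = (p ^ n)%:R * phi (- x).
Proof.
rewrite /fourier_transform; under eq_bigr do rewrite mulr_suml.
rewrite exchange_big /= (bigD1 (- x)) //= [X in _ + X]big1 ?addr0.
  rewrite (eq_bigr (fun=> phi (- x))) => [|a _].
    by rewrite sumr_const mulr_natl; congr (_ *+ _); exact: card_vec.
  by rewrite -mulrA -chiD // innerNr opprK innerC subrr mulr1.
move=> y yx.
transitivity (phi y * \sum_a chi (inner (- (x + y)) a)).
  rewrite mulr_sumr; apply: eq_bigr => a _.
  rewrite -mulrA -chiD // innerNl innerDl opprD addrC.
  by rewrite (innerC a y).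
by rewrite sum_chi_inner oppr_eq0 addrC addr_eq0 (negPf yx) mul0r mulr0.
Qed.

Definition conv (phi psi : vec -> C) x : C := \sum_y phi (x - y) * psi y.

Lemma fourier_conv phi psi a :
  fourier (conv phi psi) a = fourier phi a * fourier psi a.
Proof.
rewrite /fourier_transform mulr_sumr; under eq_bigr do rewrite mulr_suml.
rewrite exchange_big; apply: eq_bigr => y _ /=.
rewrite mulr_suml (reindex_inj (addIr y)) /=; apply: eq_bigr => x _.
by rewrite addrK innerDr opprD chiD // mulrACA.
Qed.

(** * Value distributions read off from character sums *)

Section Levels.
Variables (I : finType) (P : pred I) (F : I -> 'F_p).

Definition level j := #|[pred x | P x && (F x == j)]|.

Lemma sum_level (G : 'F_p -> C) :
  \sum_(x | P x) G (F x) = \sum_j (level j)%:R * G j.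
Proof.
rewrite (partition_big F predT) //=; apply: eq_bigr => j _.
rewrite (eq_bigr (fun=> G j)) => [|x /andP[_ /eqP ->] //].
by rewrite sumr_const mulr_natl.
Qed.

Lemma sum_level_card : \sum_j level j = #|P|.
Proof.
rewrite -sum1_card (partition_big F predT) //=.
by apply: eq_bigr => j _; rewrite sum1_card.
Qed.

Variables (m : int) (v : 'F_p).
Hypothesis sumF : \sum_(x | P x) chi (F x) = m%:~R * chi v.

Lemma level_const : exists c : int, forall j, (level j)%:Z = c + m * (j == v)%:Z.
Proof.
have sE : \sum_j ((level j)%:Z - m * (j == v)%:Z)%:~R * chi j = 0.
  under eq_bigr do rewrite intrB mulrBl /=.
  rewrite sumrB -[X in X - _]sum_level sumF.
  rewrite (bigD1 v) //= eqxx mulr1 big1 ?addr0 ?subrr // => i /negPf ->.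
  by rewrite mulr0 mul0r.
exists ((level v)%:Z - m) => j.
have /eqP := chi_indep p_pr z_prim sE j v.
by rewrite eqxx mulr1 subr_eq => /eqP.
Qed.

(** This plays the role of the Galois action z -> z^b: by [level_const] the values of F are
    equidistributed up to an excess m at v, and the constant part contributes 0 to the scaled
    sum. *)
Lemma char_sum_scale b : b != 0 ->
  \sum_(x | P x) chi (b * F x) = m%:~R * chi (b * v).
Proof.
move=> b0; have [c cE] := level_const.
rewrite (sum_level (fun j => chi (b * j))).
have lE j : (level j)%:R = c%:~R + m%:~R * (j == v)%:R :> C.
  have /(congr1 (fun i : int => i%:~R : C)) := cE j.
  by rewrite intrD intrM.
under eq_bigr do rewrite lE mulrDl.
rewrite big_split /= -mulr_sumr.
have -> : \sum_i chi (b * i) = 0.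
  by under eq_bigr do rewrite mulrC; rewrite sum_chi // (negPf b0) mul0r.
rewrite mulr0 add0r (bigD1 v) //= eqxx mulr1 big1 ?addr0 // => i /negPf ->.
by rewrite mulr0 mul0r.
Qed.

End Levels.

(** For odd p, -1 is not a p-th root of unity, so sign and exponent are determined separately. *)
Lemma sign_chi_inj (c : C) (b b' : bool) i j : c != 0 ->
  (-1) ^+ b * c * chi i = (-1) ^+ b' * c * chi j -> b = b' /\ i = j.
Proof.
move=> c0 e.
have {}e : (-1) ^+ (b (+) b') = chi (j - i).
  apply: (mulIf (chi_neq0 p_pr z_prim i)); apply: (mulfI c0).
  rewrite -chiD // subrK signr_addb.
  transitivity ((-1) ^+ b' * ((-1) ^+ b * c * chi i)); first by ring.
  by rewrite e !mulrA -expr2 sqrr_sign mul1r.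
have : b (+) b' = false.
  apply: contraTF isT => bb; have := chi_neqN1 p_odd z_prim (j - i).
  by rewrite -e bb expr1 eqxx.
move=> bb; move: e; rewrite bb => /esym/eqP; rewrite chi_eq1 // subr_eq0 => /eqP.
by case: b b' bb => [] [].
Qed.
End Fourier.

(** * Dual pairs of bent functions *)

Lemma two_neq0 (p : nat) : prime p -> odd p -> (2%:R : 'F_p) != 0.
Proof.
move=> p_pr p_odd.
by rewrite -(dvdn_pcharf (pchar_Fp p_pr)) gtnNdvd // odd_prime_gt2.
Qed.

(** For odd p the map x -> -x has no fixed point other than 0, so the nonzero elements pair off. *)
Lemma card_opp_closed (p n : nat) (p_pr : prime p) (p_odd : odd p)
    (A : {set 'rV['F_p]_n}) :
  (forall x, x \in A -> - x \in A) -> odd #|A| = (0 \in A).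
Proof.
have [m] := ubnP #|A|; elim: m A => // m IH A /ltnSE cA oA.
have [x /andP[xA x0]|A0] := pickP [pred x in A | x != 0]; last first.
  have AE : A \subset [set 0].
    by apply/subsetP => x xA; rewrite inE; have := A0 x;
      rewrite inE /= xA => /negbFE.
  move: AE; rewrite subset1 => /orP[] /eqP ->; first by rewrite cards1 inE eqxx.
  by rewrite cards0 inE.
have two := two_neq0 p_pr p_odd.
have xx : - x != x.
  by rewrite eq_sym -addr_eq0 -mulr2n -scaler_nat scaler_eq0 (negPf two).
have xA' := oA _ xA.
have <- : (0 \in A :\ x :\ - x) = (0 \in A).
  by rewrite !inE [0 == - x]eq_sym oppr_eq0 [0 == x]eq_sym (negPf x0).
have cE : #|A| = #|A :\ x :\ - x|.+2.
  by rewrite (cardsD1 x) xA (cardsD1 (- x)) !inE xx xA'.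
rewrite cE /= negbK; apply: IH => [|y]; first by rewrite cE in cA; lia.
rewrite !inE => /and3P[y1 y2 yA].
by rewrite oA // andbT eqr_opp y2 eqr_oppLR y1.
Qed.

Section Pair.
Variables (C : numClosedFieldType) (p e : nat) (z : C).
Hypotheses (p_pr : prime p) (p_odd : odd p) (z_prim : p.-primitive_root z).
Local Notation chi := (@addchar C p z).
Local Notation n := (e + e)%N.
Local Notation vec := 'rV['F_p]_n.
Local Notation q := ((p ^ e)%:R : C).
Implicit Types (f g : vec -> 'F_p) (B : {set vec}).

(* g is the dual of f and B = B_-(f); in even dimension mu = 1. *)
Definition bent_pair f g B := forall a,
  \sum_x chi (f x - inner a x) = (-1) ^+ (a \in B) * q * chi (g a).

Lemma q_neq0 : q != 0.
Proof. by rewrite pnatr_eq0 -lt0n expn_gt0 prime_gt0. Qed.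

Lemma q2 : q * q = (p ^ n)%:R.
Proof. by rewrite -natrM expnD. Qed.

Lemma bent_pair_inv f g B : bent_pair f g B ->
  forall x, \sum_a (-1) ^+ (a \in B) * chi (g a + inner a x) = q * chi (f x).
Proof.
move=> fg x; apply: (mulfI q_neq0); rewrite mulrA q2 mulr_sumr.
transitivity (\sum_a \sum_y chi (f y) * chi (inner a (x - y))).
  apply: eq_bigr => a _; rewrite chiD // !mulrA [q * _]mulrC -fg mulr_suml.
  apply: eq_bigr => y _.
  by rewrite !chiD // -mulrA innerDr innerNr chiD // [X in _ * X = _]mulrC.
rewrite exchange_big /= (bigD1 x) //= [X in _ + X]big1 ?addr0.
  under eq_bigr do rewrite subrr innerC inner0l chi0 mulr1.
  by rewrite sumr_const mulr_natl; congr (_ *+ _); apply: card_vec.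
move=> y yx; rewrite -mulr_sumr.
under eq_bigr do rewrite innerC.
by rewrite sum_chi_inner // subr_eq0 eq_sym (negPf yx) mul0r mulr0.
Qed.

(* Otherwise a sum of characters over the complement of B would have a Walsh
   value with two coefficients q/2, and q is odd. *)
Lemma bent_pair_dual f g f' B B' : (forall x, f (- x) = f x) ->
  bent_pair f g B -> bent_pair g f' B' -> f' =1 f.
Proof.
move=> f_even fg gf' x; apply/eqP/negPn/negP => ne.
pose F (a : vec) := g a - inner x a.
(* Add the Walsh value of g at x to the inversion formula at -x: the terms with a in B cancel and
   the others double. *)
have sE : \sum_(a | a \notin B) chi (F a) + \sum_(a | a \notin B) chi (F a)
    = q * chi (f x) + (-1) ^+ (x \in B') * q * chi (f' x).
  rewrite -gf' -f_even -(bent_pair_inv fg) -!big_split /= big_mkcond.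
  apply: eq_bigr => a _; rewrite /F innerNr innerC.
  by case: (a \in B); rewrite ?expr1 ?mulN1r ?addNr // mul1r.
pose N := level (fun a => a \notin B) F.
pose s : int := (-1) ^+ (x \in B') * (p ^ e)%:Z.
have sum0 : \sum_j ((N j)%:Z + (N j)%:Z - (p ^ e)%:Z * (j == f x)%:Z
    - s * (j == f' x)%:Z)%:~R * chi j = 0.
  under eq_bigr do rewrite !intrB intrD !mulrBl !mulrDl.
  rewrite !sumrB big_split /= -(sum_level _ F chi) sE.
  rewrite (bigD1 (f x)) //= eqxx mulr1 big1 ?addr0; last first.
    by move=> i /negPf ->; rewrite mulr0 mul0r.
  rewrite (bigD1 (f' x)) //= eqxx mulr1 big1 ?addr0; last first.
    by move=> i /negPf ->; rewrite mulr0 mul0r.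
  rewrite /s intrM rmorph_sign /=.
  by move: (_ * chi (f x)) (_ * chi (f' x)) => u v; rewrite addrAC addrK subrr.
have ac := chi_indep p_pr z_prim sum0.
have two := two_neq0 p_pr p_odd.
(* As 2 is invertible, [j0] differs from both [f x] and [f' x]. Comparing the coefficients at [f x]
   and [j0] then makes p^e even. *)
pose j0 := f x + (f x - f' x).
have d0 : f x - f' x != 0 by rewrite subr_eq0 eq_sym.
have j1 : (j0 == f x) = false by rewrite -subr_eq0 /j0 addrC addKr (negPf d0).
have j2 : (j0 == f' x) = false.
  by rewrite -subr_eq0 /j0 addrAC -mulr2n -mulr_natl mulf_eq0 (negPf two)
    (negPf d0).
have := ac (f x) j0; rewrite j1 j2 eqxx [f x == _]eq_sym (negPf ne).
have : odd (p ^ e) by rewrite oddX p_odd orbT.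
by move: (p ^ e)%N (N (f x)) (N j0) => P a b; lia.
Qed.

(** Substitute a^t y for the summation variable. Since a^(tk) = a, both f(a^t y) and (a x).(a^t y)
    acquire the factor a^(t+1), so the Walsh value at a x is the scaled one at x. *)
Lemma bent_pair_hom k t f g B : bent_pair f g B ->
  (forall (a : 'F_p) (x : vec), a != 0 -> f (a *: x) = a ^+ k.+1 * f x) ->
  (forall a : 'F_p, a ^+ (t * k) = a) ->
  forall (a : 'F_p) (x : vec), a != 0 ->
  (a *: x \in B) = (x \in B) /\ g (a *: x) = a ^+ t.+1 * g x.
Proof.
move=> fg fh tk a x a0.
have gal := fg x; rewrite (_ : _ * q =
  ((-1) ^+ (x \in B) * (p ^ e)%:Z)%:~R) in gal; last first.
  by rewrite intrM rmorph_sign.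
have := char_sum_scale p_pr z_prim gal (expf_neq0 t.+1 a0).
rewrite intrM rmorph_sign /= => gal'.
have := fg (a *: x).
rewrite (reindex_inj (@scalerI _ _ (a ^+ t) (expf_neq0 t a0))) /=.
rewrite (eq_bigr (fun y => chi (a ^+ t.+1 * (f y - inner x y)))) => [|y _];
  last first.
  rewrite fh ?expf_neq0 // innerZl innerZr mulrA -exprS -exprM mulnS addnC.
  by rewrite exprD tk -exprS mulrBr.
rewrite gal' => /(sign_chi_inj p_pr p_odd z_prim q_neq0)[-> ->].
by [].
Qed.

(** * Character sums over B_- of the dual and over its complement *)

Section Dual.
Variables (t : nat) (f g : vec -> 'F_p) (B B' : {set vec}).
Hypotheses (fg : bent_pair f g B) (gf : bent_pair g f B').
Hypotheses
  (g_hom : forall (a : 'F_p) (x : vec), a != 0 -> g (a *: x) = a ^+ t.+1 * g x)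
  (B_hom : forall (a : 'F_p) (x : vec), a != 0 -> (a *: x \in B) = (x \in B))
  (g_even : forall x, g (- x) = g x).

Lemma sum_inv_dual a :
  \sum_x (-1) ^+ (x \in B') * chi (f x - inner a x) = q * chi (g a).
Proof.
rewrite -g_even -(bent_pair_inv gf); apply: eq_bigr => x _.
by rewrite innerNr innerC.
Qed.

Lemma sum_split_B' (h : vec -> C) : \sum_x h x =
  \sum_(x | x \in B') h x + \sum_(x | x \notin B') h x.
Proof. by rewrite (bigID (mem B')). Qed.

(** Twice this sum is the Walsh value of f at a minus the signed sum of [sum_inv_dual]. *)
Lemma dual_sum_in1 a : \sum_(x | x \in B') chi (f x - inner a x)
   = (- (a \in B)%:Z * (p ^ e)%:Z)%:~R * chi (g a).
Proof.
have two : 2%:R != 0 :> C by rewrite pnatr_eq0.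
apply: (mulfI two).
have := fg a; have := sum_inv_dual a; rewrite !sum_split_B'.
rewrite (eq_bigr (fun x => - chi (f x - inner a x))) => [|x ->]; last first.
  by rewrite expr1 mulN1r.
rewrite sumrN [X in _ + X = _ -> _](eq_bigr (fun x => chi (f x - inner a x)));
  last first.
  by move=> x /negPf ->; rewrite mul1r.
move: (\sum_(x in B') _) (\sum_(x | x \notin B') _) => D E h1 h2.
rewrite mulr_natl mulr2n; transitivity ((D + E) - (- D + E)); first by ring.
rewrite h1 h2 intrM -pmulrn; move: q (chi _) => Q c.
by case: (a \in B); rewrite ?expr1 ?expr0 /=; ring.
Qed.

Lemma dual_sum_out1 a : \sum_(x | x \notin B') chi (f x - inner a x)
   = ((a \notin B)%:Z * (p ^ e)%:Z)%:~R * chi (g a).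
Proof.
have := fg a; rewrite sum_split_B' dual_sum_in1 => /(canRL (addKr _)) ->.
rewrite !intrM -!pmulrn; move: q (chi _) => Q c.
by case: (a \in B); rewrite ?expr1 ?expr0 /=; ring.
Qed.

(** Take the sum at b a and scale it by b^-1: the inner product returns to a.x, and g(b a) = b^(t+1)
    g(a) leaves the factor b^t. *)
Lemma dual_sum_scale (P : pred vec) (s : bool -> int) :
  (forall a, \sum_(x | P x) chi (f x - inner a x) =
    (s (a \in B))%:~R * chi (g a)) ->
  forall b a, b != 0 -> \sum_(x | P x) chi (b^-1 * f x - inner a x)
     = (s (a \in B))%:~R * chi (b ^+ t * g a).
Proof.
move=> H b a b0.
have := char_sum_scale p_pr z_prim (H (b *: a)) (invr_neq0 b0).
rewrite g_hom // B_hom // mulrA exprS mulrA mulVf // mul1r => <-.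
by apply: eq_bigr => x _; rewrite innerZl mulrBr mulrA mulVf // mul1r.
Qed.

Lemma dual_sum_in b a : b != 0 ->
  \sum_(x | x \in B') chi (b^-1 * f x - inner a x)
   = - ((a \in B)%:R * q) * chi (b ^+ t * g a).
Proof.
move=> b0; rewrite (@dual_sum_scale _ (fun s => - s%:Z * (p ^ e)%:Z)) //.
  by rewrite mulNr intrN intrM.
exact: dual_sum_in1.
Qed.

Lemma dual_sum_out b a : b != 0 ->
  \sum_(x | x \notin B') chi (b^-1 * f x - inner a x)
   = (a \notin B)%:R * q * chi (b ^+ t * g a).
Proof.
move=> b0; rewrite (@dual_sum_scale _ (fun s => (~~ s)%:Z * (p ^ e)%:Z)) //.
  by rewrite intrM.
exact: dual_sum_out1.
Qed.

(** Double counting of chi(f(x) - a.x - g(a)) over all a and all x in B': summing over x first gives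
    -q #|B|, over a first gives -q #|B'|. *)
Lemma card_dual_Bminus : (forall x, f (- x) = f x) ->
  (forall x, (- x \in B') = (x \in B')) -> #|B| = #|B'|.
Proof.
move=> f_even B'N.
apply/eqP; rewrite -(eqr_nat C); apply/eqP; apply: (mulfI q_neq0).
transitivity (- \sum_a \sum_(x in B') chi (f x - inner a x - g a)).
  rewrite -sumrN mulr_natr -sumr_const big_mkcond; apply: eq_bigr => a _.
  under eq_bigr do rewrite chiD //.
  rewrite -mulr_suml dual_sum_in1 -mulrA -chiD // subrr chi0 mulr1 mulNr intrN
    opprK.
  by case: (a \in B); rewrite ?mul1r ?mul0r.
rewrite exchange_big -sumrN mulr_natr -sumr_const; apply: eq_bigr => x xB.
have := gf (- x); rewrite f_even B'N xB expr1 mulN1r.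
have -> : - q = (- (p ^ e)%:Z)%:~R by rewrite intrN.
have N1 : (-1 : 'F_p) != 0 by rewrite oppr_eq0 oner_eq0.
move/(char_sum_scale p_pr z_prim)/(_ _ N1) => H.
transitivity (- (chi (f x) * \sum_a chi (-1 * (g a - inner (- x) a)))).
  congr (- _); rewrite mulr_sumr; apply: eq_bigr => a _.
  by rewrite -chiD // mulN1r innerNl opprK opprD innerC addrA addrAC.
by rewrite H mulN1r intrN mulNr mulrN opprK mulrCA -chiD // subrr chi0 mulr1.
Qed.

(* Parity: by evenness of f, the level sets of f in B' have even size, except
   the one of 0. *)
Lemma zero_Bminus : f 0 = 0 -> (forall x, f (- x) = f x) ->
  (forall x, (- x \in B') = (x \in B')) -> 0 \in B' -> 0 \in B /\ g 0 = 0.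
Proof.
move=> f0 f_even B'N B'0.
have := dual_sum_in1 0; under eq_bigr do rewrite inner0l subr0.
move=> /(level_const p_pr z_prim)[c cE].
have lev j : odd (level (fun x => x \in B') f j) = (j == 0).
  have -> : level (fun x => x \in B') f j = #|[set x in B' | f x == j]|.
    by apply: eq_card => x; rewrite !inE.
  rewrite card_opp_closed // ?inE ?B'0 ?f0 ?[0 == j]eq_sym // => x.
  by rewrite !inE B'N f_even.
have two := two_neq0 p_pr p_odd.
(* Otherwise all level sets of f in B' have the same size, although that of 0 is odd and that of 1
   is even. *)
have B0 : 0 \in B.
  apply: contraT => nB; have := cE 0; have := cE 1.
  rewrite (negPf nB) !(mulNr, mul0r, oppr0, addr0) => l1 l0.
  have := lev 1; have := lev 0; rewrite eqxx oner_eq0.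
  have -> : level (fun x => x \in B') f 0 = level (fun x => x \in B') f 1.
    by apply/eqP; rewrite -eqz_nat l0 l1.
  by move=> ->.
(* If g(0) is nonzero, 0 and -g(0) both differ from g(0), so their level sets have equal size,
   against their parities. *)
split=> //; apply/eqP/negPn/negP => g0.
have := cE 0; have := cE (- g 0).
have -> : (- g 0 == g 0) = false.
  by rewrite eq_sym -addr_eq0 -mulr2n -mulr_natl mulf_eq0 (negPf two) (negPf g0).
rewrite [0 == _]eq_sym (negPf g0) !mulr0 !addr0 => l1 l0.
have := lev (- g 0); have := lev 0; rewrite eqxx oppr_eq0 (negPf g0).
have -> : level (fun x => x \in B') f 0 = level (fun x => x \in B') f (- g 0).
  by apply/eqP; rewrite -eqz_nat l0 l1.
by move=> ->.
Qed.

End Dual.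
End Pair.

(** * Kloosterman sums and classes of values *)

(* The fibres of l are the orbits of a set H of units closed under powers:
   H = {1}, the squares and all units for the partitions P, D and T. *)
Definition orbit_label (p : nat) (T : Type) (l : 'F_p -> T) : Prop :=
  exists H : pred 'F_p,
  [/\ forall s, H s -> s != 0,
      forall s m, H s -> H (s ^+ m),
      forall s i, H s -> l (s * i) = l i &
      forall i j, l i = l j -> exists2 s, H s & j = s * i].

Section Kloosterman.
Variables (C : numClosedFieldType) (p : nat) (z : C).
Hypotheses (p_pr : prime p) (p_odd : odd p) (z_prim : p.-primitive_root z).
Local Notation chi := (@addchar C p z).
Variables (k t : nat).
Hypothesis kt : forall a : 'F_p, a ^+ (k * t) = a.

(** For t = 1 this is a classical Kloosterman sum; the power b^t comes from the degree of
    homogeneity of g. *)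
Definition kloosterman (v i : 'F_p) : C :=
  \sum_(b | b != 0) chi (b ^+ t * v - b^-1 * i).

Definition kloosterman_transform (u : 'F_p -> C) (v : 'F_p) : C :=
  \sum_i u i * kloosterman v i.

Lemma sum_chi_scale b : b != 0 -> \sum_v chi (b * v) = 0.
Proof.
move=> b0; under eq_bigr do rewrite mulrC.
by rewrite sum_chi // (negPf b0) mul0r.
Qed.

(** The permutation b -> b^k turns b^t into b and leaves a complete character sum without its term
    at 0. *)
Lemma kloosterman0 v : kloosterman v 0 = p%:R * (v == 0)%:R - 1.
Proof.
have kt_gt0 : (0 < k * t)%N.
  by case: posnP => // kt0; have := kt 0; rewrite kt0 expr0 => /eqP;
    rewrite oner_eq0.
move: (kt_gt0); rewrite muln_gt0 => /andP[k0 t0].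
rewrite /kloosterman (reindex_inj (h := fun b : 'F_p => b ^+ k)) /=; last first.
  by move=> a b ab; rewrite -(kt a) -(kt b) !exprM ab.
rewrite mulrC -(sum_chi p_pr z_prim) [X in _ =
  X - 1](bigD1 0) //= mul0r chi0 addrC addrK.
apply: eq_big => b; first by rewrite expf_eq0 k0.
by rewrite mulr0 subr0 -exprM kt.
Qed.

Lemma sum_kloosterman_r v : \sum_i kloosterman v i = 0.
Proof.
rewrite exchange_big big1 // => b b0 /=.
under eq_bigr do rewrite chiD // -mulNr.
by rewrite -mulr_sumr sum_chi_scale ?mulr0 // oppr_eq0 invr_neq0.
Qed.

Lemma sum_kloosterman_l i : \sum_v kloosterman v i = 0.
Proof.
rewrite exchange_big big1 // => b b0 /=.
under eq_bigr do rewrite chiD //.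
by rewrite -mulr_suml sum_chi_scale ?mul0r // expf_neq0.
Qed.

(** With w = s v and s' = s^k in H one has s'^t = s. Replacing i by s' i does not change u, and
    replacing b by s' b moves the factor from i to v. *)
Lemma kloosterman_transform_label (T : Type) (l : 'F_p -> T) u v w :
  orbit_label l -> (forall i j, l i = l j -> u i = u j) -> l v = l w ->
  kloosterman_transform u v = kloosterman_transform u w.
Proof.
move=> [H [H0 HX Hl lH]] ul /lH[s sH ->].
pose s' := s ^+ k; have s'H : H s' by apply: HX.
have s'0 : s' != 0 by apply: H0.
have -> : s = s' ^+ t by rewrite -exprM kt.
rewrite /kloosterman_transform (reindex_inj (mulfI s'0)) /=.
apply: eq_bigr => i _; rewrite (ul (s' * i) i) ?Hl //; congr (_ * _).
rewrite /kloosterman (reindex_inj (mulfI s'0)) /=; apply: eq_big => b.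
  by rewrite mulf_eq0 (negPf s'0).
move=> _; rewrite exprMn [_ ^+ t * _ ^+ t]mulrC -mulrA.
by rewrite invfM mulrACA mulVf // mul1r.
Qed.

(** Expand u(f(x)) in additive characters of F_p. The trivial character gives the first term; the
    others, indexed by b^-1, are evaluated by the hypothesis and assemble into Kloosterman sums. *)
Lemma sum_expand (I : finType) (P : pred I) (f h : I -> 'F_p)
    (s : C) (w : 'F_p) u :
  (forall b, b != 0 ->
    \sum_(x | P x) chi (b^-1 * f x - h x) = s * chi (b ^+ t * w)) ->
  p%:R * \sum_(x | P x) u (f x) * chi (- h x) =
  (\sum_i u i) * \sum_(x | P x) chi (- h x) + s * kloosterman_transform u w.
Proof.
move=> H; have pu x : p%:R * u (f x) = \sum_i u i * \sum_b chi (b * (f x - i)).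
  rewrite (bigD1 (f x)) //= [X in _ + X]big1 ?addr0.
    by rewrite sum_chi // subrr eqxx mul1r mulrC.
  by move=> i ix; rewrite sum_chi // subr_eq0 eq_sym (negPf ix) mul0r mulr0.
rewrite mulr_sumr.
transitivity (\sum_i u i * \sum_b \sum_(x | P x) chi (b * (f x - i) - h x)).
  transitivity (\sum_(x | P x) \sum_i u i * \sum_b chi (b * (f x - i) - h x)).
    apply: eq_bigr => x _; rewrite mulrA pu mulr_suml; apply: eq_bigr => i _.
    by rewrite -mulrA mulr_suml; under [in RHS]eq_bigr do rewrite chiD //.
  rewrite exchange_big; apply: eq_bigr => i _ /=.
  by rewrite -mulr_sumr exchange_big.
rewrite /kloosterman_transform mulr_suml mulr_sumr -big_split.
apply: eq_bigr => i _ /=; rewrite mulrCA -mulrDr; congr (_ * _).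
rewrite (bigD1 0) //=; congr (_ + _).
  by apply: eq_bigr => x _; rewrite mul0r add0r.
rewrite /kloosterman (reindex_inj invr_inj) mulr_sumr /=.
apply: eq_big => b; first by rewrite invr_eq0.
rewrite invr_eq0 => b0; rewrite chiD // mulrA -H // mulr_suml;
  apply: eq_bigr => x _.
rewrite -chiD //; congr chi; ring.
Qed.

End Kloosterman.

(** [y0] is only the value of h' outside the image of L. *)
Lemma factor_through (X : finType) (T : eqType) (Y : Type) (y0 : Y)
    (L : X -> T) (h : X -> Y) :
  (forall x y, L x = L y -> h x = h y) -> exists h', forall x, h x = h' (L x).
Proof.
move=> Lh; exists (fun s => if [pick x | L x == s] is Some x then h x else y0)
  => x.
by case: pickP => [y /eqP/Lh -> //|/(_ x)]; rewrite eqxx.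
Qed.

(** The first coordinate makes {0} a class of its own. Suitable choices of [l] give the classes of
    P, D and T as the fibres. *)
Definition label (p n : nat) (T : Type) (l : 'F_p -> T) (f : 'rV['F_p]_n -> 'F_p)
  (B : {set 'rV['F_p]_n}) x := (x == 0, x \in B, l (f x)).

(** * Transforms of functions constant on the classes *)

Section Duality.
Variables (C : numClosedFieldType) (p e : nat) (z : C).
Hypotheses (p_pr : prime p) (p_odd : odd p) (z_prim : p.-primitive_root z).
Local Notation chi := (@addchar C p z).
Local Notation n := (e + e)%N.
Local Notation vec := 'rV['F_p]_n.
Local Notation q := ((p ^ e)%:R : C).
Local Notation fourier := (@fourier_transform C p n z).

(** The fields are symmetric under exchanging (k, f, B) with (t, g, B'), so each transform formula
    proved from them is available in both directions. *)
Record bent_duality (k t : nat) (f g : vec -> 'F_p) (B B' : {set vec}) : Prop :=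
  BentDuality {
    bd_pair : bent_pair z f g B;
    bd_hom : forall (a : 'F_p) x, a != 0 -> f (a *: x) = a ^+ k.+1 * f x;
    bd_Bhom : forall (a : 'F_p) x, a != 0 -> (a *: x \in B) = (x \in B);
    bd_even : forall x, f (- x) = f x;
    bd_f0 : f 0 = 0;
    bd_pair' : bent_pair z g f B';
    bd_hom' : forall (a : 'F_p) x, a != 0 -> g (a *: x) = a ^+ t.+1 * g x;
    bd_Bhom' : forall (a : 'F_p) x, a != 0 -> (a *: x \in B') = (x \in B');
    bd_even' : forall x, g (- x) = g x;
    bd_g0 : g 0 = 0;
    bd_kt : forall a : 'F_p, a ^+ (k * t) = a }.

Lemma bent_dualityC k t f g B B' :
  bent_duality k t f g B B' -> bent_duality t k g f B' B.
Proof. by case=> *; split=> // a; rewrite mulnC. Qed.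

Section Transform.
Variables (k t : nat) (f g : vec -> 'F_p) (B B' : {set vec}).
Hypothesis bd : bent_duality k t f g B B'.
Local Notation K := (kloosterman_transform z t).

Lemma transform_in u a :
  p%:R * \sum_(x in B') u (f x) * chi (- inner a x) =
  (\sum_i u i) * \sum_(x in B') chi (- inner a x) - (a \in B)%:R * q * K u (g a).
Proof.
case: bd => fg fh Bh fe f0 gf gh B'h ge g0 kt.
rewrite (@sum_expand _ _ _ p_pr z_prim t _ _ _ _ (- ((a \in B)%:R * q)) (g a)).
  by rewrite mulNr.
by move=> b b0; apply: (dual_sum_in p_pr z_prim fg gf gh Bh ge).
Qed.

Lemma transform_out u a :
  p%:R * \sum_(x | x \notin B') u (f x) * chi (- inner a x) =
  (\sum_i u i) * \sum_(x | x \notin B') chi (- inner a x) +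
    (a \notin B)%:R * q * K u (g a).
Proof.
case: bd => fg fh Bh fe f0 gf gh B'h ge g0 kt.
rewrite (@sum_expand _ _ _ p_pr z_prim t _ _ _ _ ((a \notin B)%:R * q) (g a)) //.
by move=> b b0; apply: (dual_sum_out p_pr z_prim fg gf gh Bh ge).
Qed.

Variables (T : Type) (l : 'F_p -> T).
Hypothesis ol : orbit_label l.

(** A function of the label differs only at 0 from one given by f(x) on B' and on its complement.
    [c0] is this difference, and a function supported at 0 has constant transform. *)
Lemma label_split (phi : bool * bool * T -> C) : exists c0 u1 u2,
  [/\ forall i j, l i = l j -> u1 i = u1 j, forall i j, l i = l j -> u2 i = u2 j &
  forall a, fourier (phi \o label l f B') a =
    c0 + \sum_(x in B') u1 (f x) * chi (- inner a x)
       + \sum_(x | x \notin B') u2 (f x) * chi (- inner a x)].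
Proof.
pose u1 i := phi (false, true, l i); pose u2 i := phi (false, false, l i).
pose u x := if x \in B' then u1 (f x) else u2 (f x).
exists (phi (label l f B' 0) - u 0), u1, u2; split=> [i j|i j|a].
- by rewrite /u1 => ->.
- by rewrite /u2 => ->.
have -> : \sum_(x in B') u1 (f x) * chi (- inner a x) =
  \sum_(x in B') u x * chi (- inner a x).
  by apply: eq_bigr => x xB; rewrite /u xB.
have -> : \sum_(x | x \notin B') u2 (f x) * chi (- inner a x) =
  \sum_(x | x \notin B') u x * chi (- inner a x).
  by apply: eq_bigr => x /negPf xB; rewrite /u xB.
have sp : \sum_x u x * chi (- inner a x) = \sum_(x in B') u x * chi (- inner a x)
    + \sum_(x | x \notin B') u x * chi (- inner a x) by rewrite (bigID (mem B')).
rewrite -addrA -sp /fourier.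
rewrite (bigD1 0) //= [in RHS](bigD1 0) //=.
rewrite innerC inner0l oppr0 chi0 !mulr1 addrA subrK; congr (_ + _).
apply: eq_bigr => x /negPf x0; rewrite /label x0 /u /u1 /u2.
by case: (x \in B').
Qed.

(** The Kloosterman transforms depend only on the dual label, so the one remaining ingredient is the
    character sum of B', which the hypothesis controls. *)
Lemma fourier_label (phi : bool * bool * T -> C) :
  (forall a b : vec, label l g B a = label l g B b ->
     \sum_(x in B') chi (- inner a x) = \sum_(x in B') chi (- inner b x)) ->
  forall a b : vec, label l g B a = label l g B b ->
     fourier (phi \o label l f B') a = fourier (phi \o label l f B') b.
Proof.
move=> HS a b ab; have [c0 [u1 [u2 [u1l u2l E]]]] := label_split phi.
have p0 : p%:R != 0 :> C by rewrite pnatr_eq0 -lt0n prime_gt0.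
have out (c : vec) : \sum_(x | x \notin B') chi (- inner c x) =
    (c == 0)%:R * (p ^ n)%:R - \sum_(x in B') chi (- inner c x).
  have := sum_chi_inner p_pr z_prim (- c); rewrite oppr_eq0 => <-.
  rewrite [X in _ = X - _](bigID (mem B')) /= addrAC.
  under eq_bigr do rewrite -innerNl.
  rewrite [X in _ = _ - X + _](eq_bigr (fun y => chi (inner (- c) y))) => [|x _].
    by rewrite subrr add0r.
  by rewrite innerNl.
rewrite !E; apply: (mulfI p0); rewrite !mulrDr !transform_in !transform_out !out.
have Sab := HS a b ab; move: ab => [a0 aB lab].
have kt := bd_kt bd.
have Kl u : (forall i j, l i = l j -> u i = u j) -> K u (g a) = K u (g b).
  by move=> ul; apply: (kloosterman_transform_label _ kt ol ul lab).
by rewrite Sab a0 aB (Kl u1) // (Kl u2).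
Qed.

End Transform.
End Duality.

(** * The case where B_- of the dual is a subspace V: V^perp against the zeros of g in B *)

Section Subspace.
Variables (C : numClosedFieldType) (p e : nat) (z : C).
Hypotheses (p_pr : prime p) (p_odd : odd p) (z_prim : p.-primitive_root z).
Local Notation chi := (@addchar C p z).
Local Notation n := (e + e)%N.
Local Notation vec := 'rV['F_p]_n.
Local Notation q := ((p ^ e)%:R : C).
Local Notation fourier := (@fourier_transform C p n z).
Variables (k t : nat) (f g : vec -> 'F_p) (B : {set vec}) (V : {vspace vec}).
Local Notation B' := [set x in V].
Hypothesis bd : bent_duality z k t f g B B'.

Definition zeros : {set vec} := [set a in B | g a == 0].

Lemma p_neq0 : p%:R != 0 :> C.
Proof. by rewrite pnatr_eq0 -lt0n prime_gt0. Qed.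

Lemma sum_delta : \sum_(i : 'F_p) (i == 0)%:R = 1 :> C.
Proof. by rewrite (bigD1 0) //= big1 ?addr0 // => i /negPf ->. Qed.

Lemma cardV_neq0 : #|V|%:R != 0 :> C.
Proof. by rewrite pnatr_eq0 -lt0n; apply/card_gt0P; exists 0; apply: mem0v. Qed.

Lemma sum_V a : \sum_(x in B') chi (- inner a x) = (a \in orth V)%:R * #|V|%:R.
Proof.
have -> : (a \in orth V) = (- a \in orth V).
  rewrite !inE; apply: eq_forallb => y.
  by rewrite innerNl oppr_eq0.
rewrite -(sum_chi_vspace p_pr z_prim); apply: eq_big => x; first by rewrite inE.
by rewrite innerNl.
Qed.

Lemma sum_orth x :
  #|V|%:R * \sum_(a in orth V) chi (- inner x a) = (p ^ n)%:R * (x \in V)%:R.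
Proof.
have := fourierK p_pr z_prim (fun y => (y \in V)%:R) x; rewrite rpredN => <-.
rewrite {1}/fourier_transform mulr_sumr big_mkcond; apply: eq_bigr => a _.
have -> : fourier (fun y => (y \in V)%:R) a = \sum_(y in B') chi (- inner a y).
  rewrite /fourier_transform [RHS]big_mkcond; apply: eq_bigr => y _.
  by rewrite inE; case: (y \in V); rewrite ?mul1r ?mul0r.
by rewrite sum_V; case: (a \in orth V); rewrite ?mul1r ?mul0r.
Qed.

Lemma card_orth : (#|V| * #|orth V| = p ^ n)%N.
Proof.
apply/eqP; rewrite -(eqr_nat C) natrM.
have := sum_orth 0; rewrite mem0v mulr1 => <-.
by apply/eqP; congr (_ * _); rewrite -sumr_const; apply: eq_bigr => a _;
  rewrite inner0l oppr0.
Qed.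

Lemma B'N x : (- x \in B') = (x \in B').
Proof. by rewrite !inE rpredN. Qed.

Lemma zero_in_B : 0 \in B.
Proof.
case: bd => fg fh Bh fe f0 gf gh B'h ge g0 kt.
by have [] := zero_Bminus p_pr p_odd z_prim fg gf ge f0 fe B'N;
  rewrite ?inE ?mem0v.
Qed.

(** For a in V^perp the sum of chi(f(x) - a.x) over V is the one at 0, namely -q; by [dual_sum_in1]
    this forces a in B and chi(g(a)) = 1. *)
Lemma orth_sub_zeros : orth V \subset zeros.
Proof.
case: bd => fg fh Bh fe f0 gf gh B'h ge g0 kt.
apply/subsetP => a aV.
have := dual_sum_in1 p_pr z_prim fg gf ge a.
have -> : \sum_(x in B') chi (f x - inner a x) =
  \sum_(x in B') chi (f x - inner 0 x).
  by apply: eq_bigr => x; rewrite inE inner0l => xV; rewrite (inner_orth aV xV).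
rewrite (dual_sum_in1 p_pr z_prim fg gf ge) zero_in_B g0 chi0 mulr1 !mulNr
  !intrN mulNr => /oppr_inj; rewrite !intrM.
rewrite inE; case: (a \in B) => /=.
  by rewrite mul1r -[LHS]mulr1 => /(mulfI (q_neq0 C e p_pr)) /esym/eqP;
    rewrite chi_eq1.
rewrite !mul0r mul1r => q0; case: (negP (q_neq0 C e p_pr)); apply/eqP; exact: q0.
Qed.

(** The values chi(g(a)) over B sum to -q, so all level sets of g in B have a common size c, except
    that of 0, which has q fewer elements. Their total is #|B| = #|V|. *)
Lemma card_levels : exists c : nat, [/\ (p * c = #|V| + p ^ e)%N,
  (#|zeros| + p ^ e = c)%N & forall v, v != 0 -> #|[set a in B | g a == v]| = c].
Proof.
case: bd => fg fh Bh fe f0 gf gh B'h ge g0 kt.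
have := dual_sum_in1 p_pr z_prim gf fg fe 0.
under eq_bigr do rewrite inner0l subr0.
move=> /(level_const p_pr z_prim) [c cE].
have lE j : level (fun a => a \in B) g j = #|[set a in B | g a == j]|.
  by apply: eq_card => a; rewrite !inE.
have cE' j : (#|[set a in B | g a == j]|)%:Z = c - (p ^ e)%:Z * (j == 0)%:Z.
  by rewrite -lE cE !inE mem0v f0 mulN1r mulNr.
have sc := sum_level_card (fun a => a \in B) g.
(* The integer c is nonnegative, being the size of the level set of 1. *)
have c0 : c = (`|c|%N)%:Z.
  have := cE' 1; rewrite oner_eq0 mulr0 subr0 => <-; by [].
exists `|c|%N; split.
- have : (#|B|)%:Z = p%:Z * c - (p ^ e)%:Z.
    rewrite -sc -natz natr_sum.
    under eq_bigr do rewrite natz lE cE'.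
    rewrite big_split /= sumr_const card_Fp // sumrN -mulr_sumr (bigD1 0) //=
      big1.
      by rewrite addr0 mulr1 -mulr_natl natz.
    by move=> i /negPf ->.
  rewrite (card_dual_Bminus p_pr z_prim fg gf ge fe B'N) cardsE.
  by move: c0; move: (p ^ e)%N `|c|%N #|V| => a b d; nia.
- have := cE' 0; rewrite eqxx mulr1 -/zeros.
  by move: c0; move: (p ^ e)%N `|c|%N #|zeros| => a b d; lia.
move=> v v0; have := cE' v; rewrite (negPf v0) mulr0 subr0.
by move: c0; move: `|c|%N => a; lia.
Qed.

Variables (T : eqType) (l : 'F_p -> T).
Hypothesis ol : orbit_label l.
Local Notation L := (label l f B').
Local Notation L' := (label l g B).

Lemma label0 i j : l i = l j -> (i == 0) = (j == 0).
Proof.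
case: ol => H [H0 HX Hl lH] /lH[s sH ->].
by rewrite mulf_eq0 (negPf (H0 _ sH)).
Qed.

(** The transform takes functions of [L] to functions of [L'], where convolution becomes a pointwise
    product, and transforming again leads back to functions of [L]. *)
Lemma conv_label : orth V = zeros ->
  forall (phi psi : bool * bool * T -> C) (x y : vec), L x = L y ->
  conv (phi \o L) (psi \o L) x = conv (phi \o L) (psi \o L) y.
Proof.
move=> oz phi psi.
pose h := conv (phi \o L) (psi \o L).
have S1 a b : L' a = L' b ->
    \sum_(x in B') chi (- inner a x) = \sum_(x in B') chi (- inner b x).
  move=> [_ ab lab]; rewrite !sum_V oz !inE ab.
  by rewrite (label0 lab).
(* In [transform_in] for the exchanged pair, u = [i = 0] turns the left side into a sum over the
   zeros, that is over V^perp, which [sum_orth] evaluates; solve for the sum over B. *)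
have S2 x y : L x = L y ->
    \sum_(a in B) chi (- inner x a) = \sum_(a in B) chi (- inner y a).
  have E w : \sum_(a in B) chi (- inner w a) =
    p%:R * ((#|V|%:R)^-1 * ((p ^ n)%:R * (w \in B')%:R))
      + (w \in B')%:R * q * kloosterman_transform z k (fun i =>
        (i == 0)%:R) (f w).
    have := transform_in p_pr z_prim (bent_dualityC bd) (fun i => (i == 0)%:R) w.
    rewrite sum_delta mul1r => /eqP; rewrite eq_sym subr_eq => /eqP ->;
      congr (_ * _ + _).
    apply: (mulfI cardV_neq0); rewrite (mulVKf cardV_neq0) [in RHS]inE -sum_orth.
    congr (_ * _); rewrite oz [RHS]big_mkcond [LHS]big_mkcond.
    apply: eq_bigr => a _; rewrite inE.
    by case: (a \in B); case: (g a == 0); rewrite /= ?mul1r ?mul0r.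
  move=> [_ xy lxy]; rewrite !E xy.
  rewrite (@kloosterman_transform_label _ _ _ _ _ (bd_kt (bent_dualityC bd)) _
    l _ _ (f y)) //.
  by move=> i j /label0 ->.
have F1 a b : L' a = L' b -> fourier h a = fourier h b.
  move=> ab; rewrite /h !fourier_conv //.
  by congr (_ * _); apply: (fourier_label p_pr z_prim bd ol) => // c d; apply: S1.
have [h' hE] := factor_through 0 F1.
have F2 x y : L x = L y -> h (- x) = h (- y).
  move=> xy; have pn0 : (p ^ n)%:R != 0 :> C.
    by rewrite pnatr_eq0 -lt0n expn_gt0 prime_gt0.
  apply: (mulfI pn0); rewrite -!(fourierK p_pr z_prim).
  have hE' w : fourier (fourier h) w = fourier (h' \o L') w.
    by apply: eq_bigr => a _; rewrite hE.
  rewrite !hE'; apply: (fourier_label p_pr z_prim (bent_dualityC bd) ol) => //.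
have LN x : L (- x) = L x by rewrite /label oppr_eq0 B'N (bd_even bd).
by move=> x y xy; rewrite -(opprK x) -(opprK y); apply: F2; rewrite !LN.
Qed.

(** From a zero a0 outside V^perp, closure yields a function theta supported on V, depending only on
    the label, whose transform is a nonzero multiple of the indicator of the zeros. Expanding theta
    by [transform_in] makes all its coefficients at a0 vanish. *)
Lemma conv_label_orth : (#|V| < p ^ n)%N ->
  (forall (phi psi : bool * bool * T -> C) (x y : vec), L x = L y ->
  conv (phi \o L) (psi \o L) x = conv (phi \o L) (psi \o L) y) -> orth V = zeros.
Proof.
move=> Vlt conv_meas.
apply/eqP; rewrite eqEsubset orth_sub_zeros; apply/negPn/negP.
move=> /subsetPn[a0 a0Z a0V].
case: (bd) => fg fh Bh fe f0 gf gh B'h ge g0 kt.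
(* The transforms of psi0 and of theta = psi0 * psi0 - q psi0 are supported on
   B and on zeros respectively. *)
pose psi0 x : C := (x \in V)%:R * (p%:R * (f x == 0)%:R - 1).
have [psi psiE] : exists psi : bool * bool * T -> C, forall x, psi0 x = psi (L x).
  apply: (factor_through 0) => x y [_ xy lxy].
  by rewrite !inE in xy; rewrite /psi0 xy (label0 lxy).
pose K := @kloosterman_transform C p z t.
have Fpsi a : fourier psi0 a = - q * ((a \in B)%:R * (p%:R * (g a == 0)%:R - 1)).
  pose u (i : 'F_p) : C := p%:R * (i == 0)%:R - 1.
  have := transform_in p_pr z_prim bd u a.
  have -> : \sum_i u i = 0.
    by rewrite sumrB -mulr_sumr sumr_const card_Fp // sum_delta mulr1 subrr.
  have -> : kloosterman_transform z t u (g a) = p%:R * (p%:R * (g a == 0)%:R - 1).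
    rewrite /kloosterman_transform /u.
    under eq_bigr do rewrite mulrBl mul1r.
    rewrite sumrB sum_kloosterman_r // subr0 (bigD1 0) //= big1 => [|i /negPf ->].
      by rewrite addr0 mulr1 (kloosterman0 p_pr z_prim kt).
    by rewrite mulr0 mul0r.
  rewrite mul0r add0r => H; apply: (mulfI p_neq0).
  transitivity (p%:R * \sum_(x in B') u (f x) * chi (- inner a x)).
    congr (_ * _); rewrite /fourier_transform [RHS]big_mkcond;
      apply: eq_bigr => x _.
    by rewrite inE /psi0; case: (x \in V); rewrite ?mul1r ?mul0r.
  rewrite H; move: q => Q; ring.
pose theta x := conv psi0 psi0 x - q * psi0 x.
(* Off the zeros the transform of psi0 is 0 or q, the two roots of X^2 - q X; on the zeros it is -q
   (p - 1). *)
have Ftheta a : fourier theta a = q * q * (p%:R * (p%:R - 1)) * (a \in zeros)%:R.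
  have -> : fourier theta a = fourier psi0 a * fourier psi0 a - q * fourier
    psi0 a.
    rewrite -fourier_conv // /fourier_transform mulr_sumr -sumrB.
    by apply: eq_bigr => x _; rewrite /theta mulrBl mulrA.
  rewrite Fpsi inE; move: q => Q.
  by case: (a \in B); case: (g a == 0) => /=; ring.
have theta_meas x y : L x = L y -> theta x = theta y.
  move=> xy; rewrite /theta !psiE xy; congr (_ - _).
  have E w : conv psi0 psi0 w = conv (psi \o L) (psi \o L) w.
    by apply: eq_bigr => v _; rewrite !psiE.
  by rewrite !E; apply: conv_meas.
have [th thE] := factor_through 0 theta_meas.
have theta_out x : x \notin V -> theta x = 0.
  move=> xV; rewrite /theta /psi0 (negPf xV) mul0r mulr0 subr0.
  apply: big1 => y _; case: (boolP (y \in V)) => yV; last by rewrite mul0r mulr0.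
  suff /negPf -> : x - y \notin V by rewrite !mul0r.
  by apply: contra xV => xyV; rewrite -(subrK y x) rpredD.
pose u (i : 'F_p) := th (false, true, l i).
pose c0 := theta 0 - u 0.
have thetaE x : theta x = c0 * (x == 0)%:R + (x \in V)%:R * u (f x).
  case: eqVneq => [->|x0]; first by rewrite mem0v mul1r mulr1 f0 subrK.
  rewrite mulr0 add0r; case: (boolP (x \in V)) => xV;
    last by rewrite mul0r theta_out.
  by rewrite mul1r thE /label inE xV (negPf x0).
have F2 a : p%:R * fourier theta a = p%:R * c0 +
  (\sum_i u i) * ((a \in orth V)%:R * #|V|%:R)
     - (a \in B)%:R * q * K u (g a).
  rewrite -addrA -sum_V -(transform_in p_pr z_prim bd) -mulrDr; congr (_ * _).
  rewrite /fourier_transform; under eq_bigr do rewrite thetaE mulrDl.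
  rewrite big_split /= (bigD1 0) //= big1 ?addr0 => [|i /negPf ->]; last first.
    by rewrite mulr0 mul0r.
  rewrite eqxx mulr1 innerC inner0l oppr0 chi0 mulr1; congr (_ + _).
  rewrite [RHS]big_mkcond; apply: eq_bigr => x _.
  by rewrite inE; case: (x \in V); rewrite ?mul1r ?mul0r.
(* Since #|B| = #|V| < p^n, some a lies outside B; there every term of [F2] but [c0] vanishes. *)
have c0_eq : c0 = 0.
  have [a aB] : exists a, a \notin B.
    apply/existsP; rewrite -negb_forall; apply: contraL Vlt => /forallP allB.
    have -> : #|V| = #|B| by rewrite (card_dual_Bminus p_pr z_prim fg gf ge fe
      B'N) cardsE.
    rewrite -leqNgt -(card_vec n p_pr) -cardsT; apply: subset_leq_card.
    by apply/subsetP => x _; apply: allB.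
  have aV : a \notin orth V.
    by apply: contra aB => /(subsetP orth_sub_zeros); rewrite inE => /andP[].
  have := F2 a; rewrite Ftheta (negPf aV) (negPf aB) inE (negPf aB) /= !(mul0r,
    mulr0) addr0 subr0.
  by move=> /esym/eqP; rewrite mulf_eq0 (negPf p_neq0) => /eqP.
(* Each nonzero v is a value of g on B, since its level set has c >= q elements. Such a point is
   outside the zeros, so [F2] isolates [K u v]. *)
have Kv v : v != 0 -> K u v = 0.
  move=> v0; have [c [c1 c2 /(_ v v0) c3]] := card_levels.
  have /card_gt0P[a] : (0 < #|[set a in B | g a == v]|)%N.
    by rewrite c3 -c2 (leq_trans _ (leq_addl _ _)) // expn_gt0 prime_gt0.
  rewrite inE => /andP[aB /eqP gv].
  have aZ : a \notin zeros by rewrite inE aB gv.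
  have aV : a \notin orth V by apply: contra aZ => /(subsetP orth_sub_zeros).
  have := F2 a; rewrite Ftheta (negPf aV) (negPf aZ) aB gv c0_eq !(mulr0,
    mul0r) add0r sub0r.
  by move/esym/eqP; rewrite oppr_eq0 mul1r mulf_eq0 (negPf (q_neq0 _ _ _)) //
    => /eqP.
have K0 : K u 0 = 0.
  have : \sum_v K u v = 0.
    rewrite exchange_big big1 // => i _ /=.
    by rewrite -mulr_sumr sum_kloosterman_l // mulr0.
  by rewrite (bigD1 0) //= big1 ?addr0.
have := F2 a0; rewrite Ftheta (negPf a0V) a0Z c0_eq.
have := a0Z; rewrite inE => /andP[_ /eqP ->];
  rewrite K0 !(mulr0, mul0r) subr0 mulr1 addr0.
move/eqP; rewrite !mulf_eq0 (negPf p_neq0) (negPf (q_neq0 _ _ _)) //= subr_eq0.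
by rewrite pnatr_eq1 (gtn_eqF (prime_gt1 p_pr)).
Qed.

End Subspace.

(** * Association schemes of fibres *)

Section Fibres.
Variables (p n : nat).
Local Notation vec := 'rV['F_p]_n.
Variables (S : finType) (L : vec -> S).

Definition fibre x : {set vec} := [set y | L x == L y].

Lemma mem_preim_partition (A : {set vec}) :
  reflect (exists x, A = fibre x) (A \in preim_partition L [set: vec]).
Proof.
apply: (iffP imsetP) => [[x _ ->]|[x ->]]; exists x => //; apply/setP => y.
all: by rewrite !inE.
Qed.

Lemma nonempty_members_fibres (F : {set {set vec}}) :
  (forall A x y, A \in F -> x \in A -> (y \in A) = (L x == L y)) ->
  (forall x, exists2 A, A \in F & x \in A) ->
  nonempty_members F = preim_partition L [set: vec].
Proof.
move=> FA Fx.
have FE A x : A \in F -> x \in A -> A = fibre x.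
  by move=> AF xA; apply/setP => y; rewrite inE (FA A x y).
apply/setP => A; rewrite inE; apply/andP/mem_preim_partition.
  by case=> AF /set0Pn[x xA]; exists x; apply: FE.
case=> x ->; have [A' A'F xA'] := Fx x; rewrite -(FE _ _ A'F xA'); split=> //.
by apply/set0Pn; exists x.
Qed.

Hypotheses (L0 : forall x, L x = L 0 -> x = 0) (LN : forall x, L (- x) = L x).

Definition fibre_count s t x := #|[set y | (L (x - y) == s) && (L y == t)]|.

(** The relations are invariant under translation, so the intersection numbers at (x, y) depend only
    on x - y and are the fibre counts there. Labels that are not attained give count 0. *)
Lemma scheme_fibre_count :
  induces_symmetric_scheme (preim_partition L [set: vec]) <->
  (forall s t x y, L x = L y -> fibre_count s t x = fibre_count s t y).
Proof.
split=> [[d [U [Uinj PU U0 [[_ [_ _ _] _ _ cnt] _]]]] s t x y xy|cnt].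
  have inU w : exists i, U i = fibre w.
    have : fibre w \in preim_partition L [set: vec]
      by apply/mem_preim_partition; exists w.
    by rewrite PU => /imsetP[i _ ->]; exists i.
  case: (pickP [pred w | L w == s]) => [ws /eqP <-|nos]; last first.
    have E v : fibre_count s t v = 0%N.
      apply/eqP; rewrite cards_eq0; apply/eqP/setP => w; rewrite !inE.
      by have /= -> := nos (v - w).
    by rewrite !E.
  case: (pickP [pred w | L w == t]) => [wt /eqP <-|nos]; last first.
    have E v : fibre_count (L ws) t v = 0%N.
      apply/eqP; rewrite cards_eq0; apply/eqP/setP => w; rewrite !inE.
      by have /= -> := nos w; rewrite andbF.
    by rewrite !E.
  have [[u uE] [v vE] [w wE]] := And3 (inU ws) (inU wt) (inU x).
  have [m mE] := cnt u v w.
  have E c : L x = L c -> fibre_count (L ws) (L wt) c = m.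
    move=> xc; rewrite -(mE c 0); last by rewrite inE /= subr0 wE inE xc.
    by apply: eq_card => c'; rewrite !inE /= subr0 uE vE !inE [L ws == _]eq_sym
      [L wt == _]eq_sym.
  by rewrite !E.
have f0 : fibre 0 = [set 0].
  apply/setP => y; rewrite !inE; apply/eqP/eqP => [/esym/L0 //|->//].
pose P := preim_partition L [set: vec].
(* [[set 0]] is listed first so that it becomes U_0. *)
pose s := [set 0] :: enum (P :\ [set 0]); pose d := size (enum (P :\ [set 0])).
have s_uniq : uniq s by rewrite /s /= mem_enum !inE eqxx enum_uniq.
have sP A : (A \in s) = (A \in P).
  rewrite inE mem_enum !inE; case: eqVneq => //= ->.
  by apply/esym/mem_preim_partition; exists 0; rewrite f0.
pose U (i : 'I_d.+1) := nth set0 s i.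
have Us i : U i \in s by apply: mem_nth; rewrite /= ltn_ord.
have Uf i : exists x, U i = fibre x.
  by apply/mem_preim_partition; rewrite -/P -sP.
have Ui : injective U.
  move=> i j /eqP; rewrite nth_uniq //= => /eqP; exact: val_inj.
have PU : P = [set U i | i : 'I_d.+1].
  apply/setP => A; rewrite -sP; apply/idP/imsetP => [As|[i _ ->] //].
  have iA : (index A s < d.+1)%N by rewrite -[X in (_ < X)%N]/(size s) index_mem.
  by exists (Ordinal iA) => //; rewrite /U /= nth_index.
have sym i u : (u.2 - u.1 \in U i) = (u.1 - u.2 \in U i).
  have [x ->] := Uf i; by rewrite !inE -[L (u.2 - u.1)]LN opprB.
exists d, U; split=> //.
have trans j : transpose_rel [set u : vec * vec | u.1 - u.2 \in U j] =
  [set u | u.1 - u.2 \in U j].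
  by apply/setP => u; rewrite !inE /= sym.
split=> //; split.
- by apply/card_gt0P; exists 0.
- split.
  + move=> i; have [x Ux] := Uf i; apply/set0Pn; exists (x, 0).
    by rewrite inE /= subr0 Ux inE.
  + move=> i j ij; rewrite -setI_eq0; apply/eqP/setP => u; rewrite !inE.
    apply/negP => /andP[]; have [x Ux] := Uf i; have [y Uy] := Uf j.
    rewrite Ux Uy !inE => /eqP xu /eqP yu; case/eqP: ij; apply: Ui.
    by apply/setP => w; rewrite Ux Uy !inE xu yu.
  + apply/setP => u; rewrite inE; apply/bigcupP.
    have : fibre (u.1 - u.2) \in P by apply/mem_preim_partition;
      exists (u.1 - u.2).
    by rewrite PU => /imsetP[i _ iE]; exists i => //; rewrite inE -iE inE.
- by apply/setP => u; rewrite /U !inE subr_eq0.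
- by move=> j; exists j.
move=> u v w; have [x0 Uw] := Uf w; have [a Uu] := Uf u; have [b Uv] := Uf v.
exists (fibre_count (L a) (L b) x0) => x y; rewrite inE /= Uw inE => /eqP xy.
rewrite (cnt _ _ _ _ xy) /fibre_count.
rewrite -(card_imset _ (addIr (- y))); apply: eq_card => c.
rewrite !inE Uu Uv; apply/imsetP/idP => [[d0]|].
  rewrite !inE /= => /andP[/eqP La /eqP Lb] ->.
  by rewrite opprB addrA subrK La Lb !eqxx.
move=> /andP[h1 h2]; exists (c + y); last by rewrite addrK.
by rewrite !inE /= addrK [c + y]addrC opprD addrA eq_sym h1 eq_sym h2.
Qed.

Variable C : numClosedFieldType.

(** Fibre counts are convolutions of indicators of fibres, and every convolution of functions of the
    label is a combination of them. This gives the scheme condition a form accessible to the Fourier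
    transform. *)
Lemma scheme_conv :
  induces_symmetric_scheme (preim_partition L [set: vec]) <->
  (forall (phi psi : S -> C) x y, L x = L y ->
    conv (phi \o L) (psi \o L) x = conv (phi \o L) (psi \o L) y).
Proof.
apply: (iff_trans scheme_fibre_count); split=> H.
  have E phi psi x : conv (phi \o L) (psi \o L) x =
      \sum_(st : S * S) (fibre_count st.1 st.2 x)%:R * (phi st.1 * psi st.2) :> C.
    rewrite /conv (partition_big (fun y => (L (x - y), L y)) predT) //=.
    apply: eq_bigr => -[s t] _ /=.
    rewrite (eq_bigr (fun=> phi s * psi t)) => [|y /eqP[-> ->] //].
    by rewrite sumr_const mulr_natl; congr (_ *+ _); apply: eq_card => y;
      rewrite !inE.
  by move=> phi psi x y xy; rewrite !E; apply: eq_bigr => st _;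
    rewrite (H _ _ _ _ xy).
move=> s t x y xy.
have E w : (fibre_count s t w)%:R = conv ((fun s' =>
  (s' == s)%:R : C) \o L) ((fun s' => (s' == t)%:R : C) \o L) w.
  rewrite /conv /fibre_count -sum1_card natr_sum big_mkcond;
    apply: eq_bigr => c _.
  by rewrite inE /=; case: (L (w - c) == s); case: (L c == t);
    rewrite /= ?mulr1 ?mulr0.
by apply/eqP; rewrite -(eqr_nat C) !E; apply/eqP/H.
Qed.

End Fibres.

(** * The three partitions *)

Section Labels.
Variables (p : nat).
Hypothesis p_pr : prime p.

Lemma Fp_expp (a : 'F_p) : a ^+ p = a.
Proof. by rewrite -[RHS]expf_card card_Fp. Qed.

(** Bezout gives t k = m (p - 1) + 1, and a^p = a removes the multiples of p - 1, also for a = 0. *)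
Lemma Fp_exp_inverse k : (0 < k)%N -> coprime k p.-1 ->
  exists t, forall a : 'F_p, a ^+ (k * t) = a.
Proof.
move=> k0 kp; case: (egcdnP p.-1 k0) => t m tE _.
exists t => a; rewrite mulnC tE (eqP kp) addn1.
elim: m {tE} => [|m IH]; first by rewrite expr1.
by rewrite mulSn addnC -addSn exprD IH -exprS prednK ?prime_gt0 // Fp_expp.
Qed.

Lemma Fp_generator : exists c : 'F_p, forall a, a != 0 -> exists m, a = c ^+ m.
Proof.
have p1 : (0 < p.-1)%N by rewrite -subn1 subn_gt0 prime_gt1.
have rt a : a != 0 -> a ^+ p.-1 = 1 :> 'F_p.
  by move=> a0; apply: (mulfI a0);
    rewrite -exprS prednK ?prime_gt0 // Fp_expp mulr1.
have : has p.-1.-primitive_root (enum [set~ 0 : 'F_p]).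
  apply: cyclic.has_prim_root => //.
  - by apply/allP => a; rewrite mem_enum !inE unity_rootE => /rt ->.
  - exact: enum_uniq.
  - by rewrite -cardE cardsC1 card_Fp.
case/hasP=> c _ cp; exists c => a /rt /(prim_rootP cp)[i ->].
by exists i.
Qed.

(** A quotient of two nonsquares is a square, as both are odd powers of a generator of the unit
    group. *)
Lemma SQ_div (i j : 'F_p) : i != 0 -> j != 0 -> (i \in SQ p) = (j \in SQ p) ->
  exists2 s, s \in SQ p & j = s * i.
Proof.
have [c cE] := Fp_generator.
have par m : c ^+ m != 0 -> c ^+ m \notin SQ p -> odd m.
  move=> c0; apply: contraR => om; rewrite inE c0; apply/existsP.
  by exists (c ^+ m./2); rewrite -exprM muln2 -[X in c ^+ X
    == _]odd_double_half (negPf om).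
move=> i0 j0 ij; exists (j / i); last by rewrite divfK.
rewrite inE mulf_neq0 ?invr_neq0 //; apply/existsP.
case: (boolP (i \in SQ p)) ij => iS /esym jS.
  move: iS jS; rewrite !inE => /andP[_ /existsP[a /eqP ->]] /andP[_ /existsP[b
    /eqP ->]].
  by exists (b / a); rewrite expr_div_n.
have [[a aE] [b bE]] := (cE i i0, cE j j0).
have oa : odd a by apply: par; rewrite -aE.
have ob : odd b by apply: par; rewrite -bE ?jS.
have ab : (a + b = (a + b)./2 * 2)%N.
  by rewrite muln2 -[LHS]odd_double_half oddD oa ob.
exists (c ^+ (a + b)./2 / i); rewrite expr_div_n -exprM -ab exprD -aE -bE.
by rewrite -mulf_div divff // mul1r.
Qed.

Lemma orbit_label_id : orbit_label (@id 'F_p).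
Proof.
exists (fun s => s == 1); split=> [s /eqP ->|s m /eqP ->|s i /eqP ->|i j ->].
- exact: oner_neq0.
- by rewrite expr1n.
- by rewrite mul1r.
- by exists 1; rewrite // mul1r.
Qed.

Lemma orbit_label_eq0 : orbit_label (fun i : 'F_p => i == 0).
Proof.
exists (fun s => s != 0); split=> [s //|s m|s i|i j ij].
- exact: expf_neq0.
- by move=> /negPf s0; rewrite mulf_eq0 s0.
- case: (eqVneq i 0) ij => [-> /esym/eqP ->|i0 /esym/negbT j0].
    by exists 1; rewrite ?oner_neq0 ?mulr0.
  by exists (j / i); rewrite ?divfK // mulf_neq0 ?invr_neq0.
Qed.

Lemma orbit_label_SQ : orbit_label (fun i : 'F_p => (i == 0, i \in SQ p)).
Proof.
exists (fun s => s \in SQ p).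
have S0 s : s \in SQ p -> s != 0 by rewrite inE => /andP[].
split=> [s /S0 //|s m|s i sS|i j [ij ijS]].
- rewrite !inE => /andP[s0 /existsP[a /eqP sE]]; rewrite expf_neq0 //=.
  by apply/existsP; exists (a ^+ m); rewrite sE exprAC.
- have s0 := S0 _ sS; congr (_, _); first by rewrite mulf_eq0 (negPf s0).
  move: sS; rewrite !inE mulf_eq0 (negPf s0) /= => /existsP[a /eqP sE].
  case: (eqVneq i 0) => //= i0; apply/existsP/existsP => -[b /eqP bE].
    exists (b / a); rewrite expr_div_n -bE -sE mulrAC divff ?mul1r //.
  by exists (a * b); rewrite exprMn -bE sE.
- case: (eqVneq i 0) ij => [-> /esym/eqP ->|i0 /esym/negbT j0].
    exists 1; rewrite ?mulr0 // inE oner_neq0; apply/existsP; exists 1.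
    by rewrite expr1n.
  exact: SQ_div.
Qed.

End Labels.

Section Cells.
Variables (p n : nat) (f : 'rV['F_p]_n -> 'F_p) (B' : {set 'rV['F_p]_n}).
Variables (T : finType) (l : 'F_p -> T).

Definition cell (b : bool) (s : T) : {set 'rV['F_p]_n} :=
  [set x | [&& x != 0, (x \in B') == b & l (f x) == s]].

Lemma nonempty_members_label (F : {set {set 'rV['F_p]_n}}) :
  (forall A, A \in F -> A = [set 0] \/ exists b s, A = cell b s) ->
  [set 0] \in F -> (forall b x, cell b (l (f x)) \in F) ->
  nonempty_members F = preim_partition (label l f B') [set: _].
Proof.
move=> Fcell F0 Fx; apply: nonempty_members_fibres => [A x y AF|x].
  have [->|[b [s ->]]] := Fcell A AF.
    rewrite !inE => /eqP ->; rewrite !xpair_eqE eqxx.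
    by case: (eqVneq y 0) => //= ->; rewrite !eqxx.
  rewrite !inE => /and3P[/negPf x0 /eqP <- /eqP <-].
  rewrite !xpair_eqE x0 [false == _]eq_sym eqbF_neg -andbA.
  by rewrite [(y \in B') == _]eq_sym [l (f y) == _]eq_sym.
have [->|x0] := eqVneq x 0; first by exists [set 0]; rewrite ?inE.
by exists (cell (x \in B') (l (f x))); rewrite ?Fx // inE x0 !eqxx.
Qed.

End Cells.

(** * P, D and T as partitions into fibres of labels *)

Section Partitions.
Variables (R : realType) (p n : nat).
Variables (f : 'rV['F_p]_n -> 'F_p) (V : {vspace 'rV['F_p]_n}).
Hypotheses (p_pr : prime p) (f0 : f 0 = 0).
Hypothesis Bp : Bplus R (bent_dual R f) = [set x | x \notin V].
Hypothesis Bm : Bminus R (bent_dual R f) = [set x in V].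

Lemma mem_cset j x : (x \in cset R f j) = (x \notin V) && (f x == j).
Proof. by rewrite inE Bp inE. Qed.

Lemma mem_dset j x : (x \in dset R f j) = (x \in V) && (f x == j).
Proof. by rewrite inE Bm inE. Qed.

Lemma mem_bigcup_cset (J : {set 'F_p}) x :
  (x \in \bigcup_(i in J) cset R f i) = (x \notin V) && (f x \in J).
Proof.
apply/bigcupP/andP => [[i iJ]|[xV xJ]].
  by rewrite mem_cset => /andP[xV /eqP ->].
by exists (f x); rewrite // mem_cset xV eqxx.
Qed.

Lemma mem_bigcup_dset (J : {set 'F_p}) x :
  (x \in \bigcup_(i in J) dset R f i) = (x \in V) && (f x \in J).
Proof.
apply/bigcupP/andP => [[i iJ]|[xV xJ]].
  by rewrite mem_dset => /andP[xV /eqP ->].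
by exists (f x); rewrite // mem_dset xV eqxx.
Qed.

Lemma notin_V_neq0 x : x \notin V -> x != 0.
Proof. by apply: contraNneq => ->; apply: mem0v. Qed.

Lemma cell_false (T : finType) (l : 'F_p -> T) s (A : {set 'rV['F_p]_n}) :
  (forall x, (x \in A) = (x \notin V) && (l (f x) == s)) ->
  A = cell f [set x in V] l false s.
Proof.
move=> AE; apply/setP => x; rewrite AE !inE eqbF_neg.
by case: (boolP (x \in V)) => xV; rewrite ?andbF ?(notin_V_neq0 xV).
Qed.

Lemma cell_true (T : finType) (l : 'F_p -> T) s (A : {set 'rV['F_p]_n}) :
  (forall x, (x \in A) = [&& x != 0, x \in V & l (f x) == s]) ->
  A = cell f [set x in V] l true s.
Proof. by move=> AE; apply/setP => x; rewrite AE !inE eqb_id. Qed.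

Lemma mem_cset0 x : (x \in cset R f 0 :\ 0) = (x \notin V) && (f x == 0).
Proof.
rewrite in_setD1 mem_cset; case: (boolP (x \in V)) => xV; rewrite ?andbF //.
by rewrite (notin_V_neq0 xV).
Qed.

Lemma mem_dset0 x : (x \in dset R f 0 :\ 0) = [&& x != 0, x \in V & f x == 0].
Proof. by rewrite in_setD1 mem_dset. Qed.

Lemma f_neq0 x : f x != 0 -> x != 0.
Proof. by apply: contraNneq => ->; rewrite f0. Qed.

Lemma Ppart_label : Ppart R f =
  preim_partition (label id f [set x in V]) [set: _].
Proof.
have cE j : j != 0 -> cset R f j = cell f [set x in V] id false j.
  by move=> j0; apply: cell_false => x; rewrite mem_cset.
have dE j : j != 0 -> dset R f j = cell f [set x in V] id true j.
  move=> j0; apply: cell_true => x; rewrite mem_dset.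
  case: eqVneq => [fx|]; rewrite ?andbF // !andbT.
  by rewrite f_neq0 // fx.
have c0 : cset R f 0 :\ 0 = cell f [set x in V] id false 0.
  by apply: cell_false => x; rewrite mem_cset0.
have d0 : dset R f 0 :\ 0 = cell f [set x in V] id true 0.
  by apply: cell_true => x; rewrite mem_dset0.
apply: nonempty_members_label => [A||b x]; rewrite !inE.
- rewrite -!orbA => /or4P[/eqP ->|/eqP ->|/eqP ->|/orP[] /imsetP[j]].
  + by left.
  + by right; exists false, 0.
  + by right; exists true, 0.
  + by rewrite !inE => /cE -> ->; right; exists false, j.
  + by rewrite !inE => /dE -> ->; right; exists true, j.
- by rewrite eqxx.
have [->|fx] := eqVneq (f x) 0; first by case: b; rewrite -?c0 -?d0 eqxx ?orbT.
have cI : cset R f (f x) \in [set cset R f j | j in [set~ 0]] by apply: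
  imset_f; rewrite !inE.
have dI : dset R f (f x) \in [set dset R f j | j in [set~ 0]] by apply:
  imset_f; rewrite !inE.
by case: b; rewrite -?cE -?dE // ?cI ?dI ?orbT.
Qed.

Lemma NSQ_E i : (i \in NSQ p) = ((i == 0, i \in SQ p) == (false, false)).
Proof. by rewrite xpair_eqE !inE; case: (i == 0) => //=; rewrite eqbF_neg. Qed.

Lemma SQ_E i : (i \in SQ p) = ((i == 0, i \in SQ p) == (false, true)).
Proof. by rewrite xpair_eqE !inE; case: (i == 0) => //=; rewrite eqb_id. Qed.

Lemma zero_E (i : 'F_p) : (i == 0) = ((i == 0, i \in SQ p) == (true, false)).
Proof. by rewrite xpair_eqE !inE; case: (i == 0). Qed.

Lemma Dpart_label : Dpart R f =
  preim_partition (label (fun i => (i == 0, i \in SQ p)) f [set x in V]) [set: _].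
Proof.
set l := fun i : 'F_p => _.
have c0 : cset R f 0 :\ 0 = cell f [set x in V] l false (true, false).
  by apply: cell_false => x; rewrite mem_cset0 -zero_E.
have d0 : dset R f 0 :\ 0 = cell f [set x in V] l true (true, false).
  by apply: cell_true => x; rewrite mem_dset0 -zero_E.
have cs : \bigcup_(i in SQ p) cset R f i = cell f [set x in V] l false (false,
  true).
  by apply: cell_false => x; rewrite mem_bigcup_cset -SQ_E.
have cn : \bigcup_(i in NSQ p) cset R f i = cell f [set x in V] l false (false,
  false).
  by apply: cell_false => x; rewrite mem_bigcup_cset -NSQ_E.
have ds : \bigcup_(i in SQ p) dset R f i = cell f [set x in V] l true (false,
  true).
  apply: cell_true => x; rewrite mem_bigcup_dset -SQ_E.
  by case: (eqVneq x 0) => [->|] //=; rewrite f0 inE eqxx andbF.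
have dn : \bigcup_(i in NSQ p) dset R f i = cell f [set x in V] l true (false,
  false).
  apply: cell_true => x; rewrite mem_bigcup_dset -NSQ_E.
  by case: (eqVneq x 0) => [->|] //=; rewrite f0 inE eqxx andbF.
apply: nonempty_members_label => [A||b x]; rewrite !inE c0 d0 cs cn ds dn.
- rewrite -!orbA => /orP[/eqP ->|]; first by left.
  by do 5?[move=> /orP[/eqP ->|]]; last move=> /eqP ->; right; do 2 eexists.
- by rewrite eqxx.
rewrite /l; case: (eqVneq (f x) 0) => [->|fx].
  have -> : (0 : 'F_p) \in SQ p = false by rewrite inE eqxx.
  by case: b; rewrite eqxx ?orbT.
by case: (f x \in SQ p); case: b; rewrite eqxx ?orbT.
Qed.

Lemma Tpart_label : Tpart R f =
  preim_partition (label (fun i => i == 0) f [set x in V]) [set: _].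
Proof.
set l := fun i : 'F_p => _.
have c0 : cset R f 0 :\ 0 = cell f [set x in V] l false true.
  by apply: cell_false => x; rewrite mem_cset0 eqb_id.
have d0 : dset R f 0 :\ 0 = cell f [set x in V] l true true.
  by apply: cell_true => x; rewrite mem_dset0 eqb_id.
have cn : \bigcup_(i in [set~ 0]) cset R f i = cell f [set x in V] l false false.
  by apply: cell_false => x; rewrite mem_bigcup_cset !inE eqbF_neg.
have dn : \bigcup_(i in [set~ 0]) dset R f i = cell f [set x in V] l true false.
  apply: cell_true => x; rewrite mem_bigcup_dset !inE eqbF_neg /l.
  by case: (eqVneq x 0) => [->|] //=; rewrite f0 eqxx andbF.
apply: nonempty_members_label => [A||b x]; rewrite !inE c0 d0 cn dn.
- rewrite -!orbA => /orP[/eqP ->|]; first by left.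
  by do 3?[move=> /orP[/eqP ->|]]; last move=> /eqP ->; right; do 2 eexists.
- by rewrite eqxx.
by case: (l (f x)); case: b; rewrite eqxx ?orbT.
Qed.

End Partitions.

(** * The criterion *)

Section Bent.
Variables (R : realType) (p e : nat).
Hypotheses (p_pr : prime p) (p_odd : odd p).
Local Notation n := (e + e)%N.
Local Notation vec := 'rV['F_p]_n.
Local Notation xi := (xi R p).

Lemma expc_cos_sin (a : R) m :
  (Complex (cos a) (sin a)) ^+ m = Complex (cos (m%:R * a)) (sin (m%:R * a)).
Proof.
elim: m => [|m IH]; first by rewrite mul0r cos0 sin0.
rewrite exprS IH -natr1 mulrDl mul1r [_ + a]addrC cosD sinD.
by apply/eqP; rewrite eq_complex /= [sin a * _ + _]addrC !eqxx.
Qed.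

(** The order divides the prime p, and it is not 1 because p > 2 makes sin(2 pi / p) positive. *)
Lemma xi_prim : p.-primitive_root xi.
Proof.
have p0 := prime_gt0 p_pr.
have pR0 : p%:R != 0 :> R by rewrite pnatr_eq0 -lt0n.
have xip : xi ^+ p = 1.
  rewrite expc_cos_sin mulrC divfK // mulr_natl cos2pi sin2pi //.
have [m xim mp] := prim_order_exists p0 xip.
case/primeP: p_pr => _ /(_ m mp)/orP[]/eqP mE; last by move: xim; rewrite mE.
move: (prim_expr_order xim); rewrite mE expr1 => /(congr1 (@complex.Im R)) /= s0.
have p2 : 2%:R < p%:R :> R by rewrite ltr_nat odd_prime_gt2.
have : 0 < sin (2 * pi / p%:R : R).
  apply: sin_gt0_pi; rewrite divr_gt0 ?mulr_gt0 ?pi_gt0 ?ltr0n //=.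
  by rewrite ltr_pdivrMr ?ltr0n // mulrC ltr_pM2l ?pi_gt0.
by rewrite s0 ltxx.
Qed.

Lemma half_powE : half_pow R p n = (p ^ e)%:R.
Proof.
rewrite /half_pow exprD -expr2 sqrtr_sqr ger0_norm ?exprn_ge0 ?ler0n //.
by rewrite -natrX rmorph_nat.
Qed.

Lemma muE : mu R p n = 1.
Proof.
rewrite /mu expnD.
suff -> : (p ^ e * p ^ e == 1 %[mod 4])%N by [].
have : odd (p ^ e) by rewrite oddX p_odd orbT.
move: (p ^ e)%N => a oa; rewrite -(odd_double_half a) oa.
have -> : ((true + a./2.*2) * (true + a./2.*2) = (a./2 * a./2 + a./2) * 4 + 1)%N.
  by rewrite -muln2 /=; lia.
by rewrite modnMDl.
Qed.

(** [char_sum_norm] ensures that the choice in [bent_dual] finds an exponent; the two signs give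
    different values, so B_+ is the complement of B_-. *)
Lemma bent_bent_pair (f : vec -> 'F_p) : bent R f ->
  bent_pair xi f (bent_dual R f) (Bminus R f) /\
  Bplus R f = [set x | x \notin Bminus R f].
Proof.
move=> fb.
have q0 := q_neq0 R[i] e p_pr.
have W a : walsh R f a = \sum_x addchar xi (f x - inner a x) by [].
have [j jE] : exists g : vec -> 'F_p, forall a,
    walsh R f a = (p ^ e)%:R * addchar xi (g a) \/ walsh R f a =
      - (p ^ e)%:R * addchar xi (g a).
  suff H (a : vec) : exists j : 'F_p,
    (walsh R f a == (p ^ e)%:R * addchar xi j) || (walsh R f a == - (p ^ e)%:R
      * addchar xi j).
    by exists (fun a => xchoose (H a)) => a;
      case/orP: (xchooseP (H a)) => /eqP; [left|right].
  have := fb a; rewrite half_powE W => /(char_sum_norm p_pr p_odd xi_prim)[j jE].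
  by exists j; case: jE => ->; rewrite eqxx ?orbT.
have dE a : walsh R f a = (p ^ e)%:R * addchar xi (bent_dual R f a)
    \/ walsh R f a = - (p ^ e)%:R * addchar xi (bent_dual R f a).
  rewrite /bent_dual; case: pickP => [i|/(_ (j a))].
    by rewrite muE half_powE mul1r mulN1r => /orP[] /eqP; [left|right].
  by rewrite muE half_powE mul1r mulN1r; case: (jE a) => ->;
    rewrite /= eqxx ?orbT.
have BpE a : (a \in Bplus R f) =
  (walsh R f a == (p ^ e)%:R * addchar xi (bent_dual R f a)).
  by rewrite inE muE half_powE mul1r.
have BmE a : (a \in Bminus R f) =
  (walsh R f a == - (p ^ e)%:R * addchar xi (bent_dual R f a)).
  by rewrite inE muE half_powE mulN1r.
split=> [a|].
  rewrite -W; case: (boolP (a \in Bminus R f)) => [|aB].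
    by rewrite BmE expr1 mulN1r => /eqP.
  by case: (dE a) => aE; [rewrite mul1r | move: aB; rewrite BmE aE eqxx].
have ne (c : 'F_p) : ((p ^ e)%:R * addchar xi c == - (p ^ e)%:R * addchar xi c)
  = false.
  rewrite mulNr -addr_eq0 -mulr2n mulrn_eq0 /= mulf_eq0 (negPf q0).
  by rewrite (negPf (chi_neq0 p_pr xi_prim c)).
apply/setP => a; rewrite BpE [RHS]inE BmE.
by case: (dE a) => ->; rewrite eqxx ?[_ == (p ^ e)%:R * _]eq_sym ne.
Qed.

End Bent.

(** Here o = #|V^perp|, m = #|Z| and r = e + 1 + d. With Q = p^e and P = p^(d+1) the relations read
    P o = Q and p m + p Q = P Q + Q. If d > 0, then P >= p^2 gives p o <= Q, and o = m would force P
    <= p. *)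
Lemma exponent_criterion (p e d o m : nat) : (2 < p)%N ->
  (p ^ (e + 1 + d) * o = p ^ (e + e))%N ->
  (p * (m + p ^ e) = p ^ (e + 1 + d) + p ^ e)%N ->
  o = m <-> d = 0%N.
Proof.
move=> p3; have p0 : (0 < p)%N by apply: leq_trans p3.
have : (0 < p ^ e)%N by rewrite expn_gt0 p0.
rewrite -addnA add1n !expnD -mulnA; move: (p ^ e)%N => Q Q0 /eqP.
rewrite eqn_pmul2l // => /eqP; case: d => [|d]; first by rewrite expn1;
  split=> //; nia.
have : (p * p <= p ^ d.+2)%N.
  by rewrite !expnS mulnA leq_pmulr // expn_gt0 p0.
move: (p ^ d.+2)%N => P Pp oP pm; split=> // om.
exfalso; rewrite -{}om in pm.
have po : (p * o <= Q)%N by nia.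
have : (P * Q <= p * Q)%N by nia.
by rewrite leq_pmul2r //; nia.
Qed.

(** * Comparison of cardinalities and the criterion for a general label *)

Section Criterion.
Variables (R : realType) (p e r : nat).
Hypotheses (p_pr : prime p) (p_odd : odd p).
Local Notation n := (e + e)%N.
Local Notation vec := 'rV['F_p]_n.
Variables (k t : nat) (f g : vec -> 'F_p) (B : {set vec}) (V : {vspace vec}).
Hypothesis bd : bent_duality (xi R p) k t f g B [set x in V].
Hypotheses (V_dim : \dim V = r) (r_bounds : (e + 1 <= r <= n - 1)%N).

Lemma cardV : #|V| = (p ^ r)%N.
Proof. by rewrite card_vspace card_Fp // V_dim. Qed.

Lemma orth_eq_zeros : orth V = zeros g B <-> r = (e + 1)%N.
Proof.
have z_prim := xi_prim R p_pr p_odd.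
have sub := orth_sub_zeros p_pr p_odd z_prim bd.
have [c [c1 c2 _]] := card_levels p_pr p_odd z_prim bd.
have co := card_orth p_pr z_prim V; rewrite cardV in co c1.
have p3 : (2 < p)%N by apply: odd_prime_gt2.
have oz : orth V = zeros g B <-> #|orth V| = #|zeros g B|.
  split=> [->//|E]; apply/eqP; by rewrite eqEcard sub E leqnn.
apply: (iff_trans oz).
have [d rE] : exists d, r = (e + 1 + d)%N by exists (r - (e + 1))%N; lia.
rewrite rE in co c1 *; rewrite -c2 in c1.
rewrite (exponent_criterion p3 co c1); lia.
Qed.

Lemma scheme_criterion (T : finType) (l : 'F_p -> T) : orbit_label l ->
  induces_symmetric_scheme (preim_partition (label l f [set x in V]) [set: vec])
  <-> r = (e + 1)%N.
Proof.
move=> ol; have z_prim := xi_prim R p_pr p_odd.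
have L0 x : label l f [set x in V] x = label l f [set x in V] 0 -> x = 0.
  by rewrite /label eqxx => -[/eqP].
have LN x : label l f [set x in V] (- x) = label l f [set x in V] x.
  by rewrite /label oppr_eq0 !inE rpredN (bd_even bd).
apply: (iff_trans (scheme_conv L0 LN R[i])); apply: (iff_trans _ orth_eq_zeros).
split; first apply: (conv_label_orth p_pr p_odd z_prim bd ol).
  (* The bound r <= n - 1 makes V a proper subspace. *)
  by rewrite cardV ltn_exp2l ?prime_gt1 //; lia.
exact: (conv_label p_pr z_prim bd ol).
Qed.

End Criterion.

Theorem proposition3 (R : realType) (p n r : nat)
    (f : 'rV['F_p]_n -> 'F_p) (V : {vspace 'rV['F_p]_n})
    (p_prime : prime p) (p_odd : odd p)
    (n_ge4 : (4 <= n)%N) (n_even : ~~ odd n)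
    (f_bent : bent R f) (f_nwr : ~ weakly_regular R f) (f_DBF : DBF R f)
    (BminusV : Bminus R (bent_dual R f) = [set x in V])
    (V_nondeg : nondegenerate_subspace V) (V_dim : \dim V = r)
    (r_bounds : (n %/ 2 + 1 <= r <= n - 1)%N) :
  [/\ partition (Ppart R f) [set: 'rV['F_p]_n],
      partition (Dpart R f) [set: 'rV['F_p]_n] &
      partition (Tpart R f) [set: 'rV['F_p]_n]]
  /\
  [/\ induces_symmetric_scheme (Ppart R f) <-> r = (n %/ 2 + 1)%N,
      induces_symmetric_scheme (Dpart R f) <-> r = (n %/ 2 + 1)%N &
      induces_symmetric_scheme (Tpart R f) <-> r = (n %/ 2 + 1)%N].
Proof.
have [e ne] : exists e, n = (e + e)%N.
  by exists n./2; rewrite addnn even_halfK.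
subst n; have e2 : ((e + e) %/ 2 = e)%N by rewrite addnn -muln2 mulnK.
rewrite e2 in r_bounds *.
have [[_ g_bent] f0 [h [h0 hp fh]]] := f_DBF.
set g := bent_dual R f in g_bent BminusV *.
have xip := xi_prim R p_prime p_odd.
have [fg _] := bent_bent_pair p_prime p_odd f_bent.
have [gf' BpE] := bent_bent_pair p_prime p_odd g_bent.
have {}BpE : Bplus R g = [set x | x \notin V].
  by rewrite BpE BminusV; apply/setP => x; rewrite !inE.
have p3 : (2 < p)%N by apply: odd_prime_gt2.
(* h = 1 would give gcd(0, p - 1) = p - 1, which is at least 2. *)
have h1 : (0 < h - 1)%N.
  rewrite lt0n; apply/eqP => h1; move: hp; rewrite h1 gcd0n; lia.
have [t kt] : exists t, forall a : 'F_p, a ^+ ((h - 1) * t) = a.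
  by apply: Fp_exp_inverse => //; rewrite /coprime -subn1 hp.
have fh' (a : 'F_p) x : a != 0 -> f (a *: x) = a ^+ (h - 1).+1 * f x.
  by rewrite subn1 prednK //; apply: fh.
have tk (a : 'F_p) : a ^+ (t * (h - 1)) = a by rewrite mulnC.
have Fhom := bent_pair_hom p_prime p_odd xip fg fh' tk.
(* At a = -1 the identity a^(ks) = a forces k to be odd, so (-1)^(k+1) = 1. *)
have even k s (f' : 'rV['F_p]_(e + e) -> 'F_p) : (forall a : 'F_p,
  a ^+ (k * s) = a) ->
    (forall (a : 'F_p) x, a != 0 -> f' (a *: x) = a ^+ k.+1 * f' x) ->
    forall x, f' (- x) = f' x.
  move=> ks f'h x; rewrite -scaleN1r f'h ?oppr_eq0 ?oner_neq0 //.
  have N1 : (-1 : 'F_p) != 1.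
    rewrite eq_sym -addr_eq0 -[1 + 1]/(2%:R).
    by rewrite -(dvdn_pcharf (pchar_Fp p_prime)) gtnNdvd.
  have : odd k.
    apply: contraNT N1 => /negPf ok; have := ks (-1).
    by rewrite exprM -signr_odd ok expr1n => <-.
  by move=> ok; rewrite -signr_odd /= ok mul1r.
have f_even := even _ _ _ kt fh'.
have g_even := even _ _ _ tk (fun a x a0 => (Fhom a x a0).2).
(* The dual of g is so far only [bent_dual R g]; evenness of f allows [bent_pair_dual] to identify
   it with f. *)
have gf : bent_pair (xi R p) g f (Bminus R g).
  have fE := bent_pair_dual p_prime p_odd xip f_even fg gf'.
  by move=> a; rewrite gf' fE.
rewrite BminusV in gf.
have bd : bent_duality (xi R p) (h - 1) t f g (Bminus R f) [set x in V].
  split=> //.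
  - by move=> a x /(Fhom a x)[].
  - by move=> a x /(Fhom a x)[].
  - by move=> a x a0; rewrite !inE rpredZeq (negPf a0).
  (* The remaining field is g(0) = 0, which the parity argument provides because 0 lies in V. *)
  - have BN x : (- x \in [set x in V]) =
    (x \in [set x in V]) by rewrite !inE rpredN.
    have [] := zero_Bminus p_prime p_odd xip fg gf g_even f0 f_even BN => //.
    by rewrite inE mem0v.
rewrite (Ppart_label f0 BpE BminusV) (Dpart_label f0 BpE BminusV) (Tpart_label
  f0 BpE BminusV).
split; first by split; apply: preim_partitionP.
have crit := scheme_criterion p_prime p_odd bd V_dim r_bounds.
by split; apply: crit; [apply: orbit_label_id|apply: orbit_label_SQ|apply:
  orbit_label_eq0].
Qed.
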